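(* Let $\mathbb{F}$ be a field, $R=\mathbb{F}[[\pi]]$, let $(X,v)$ be a finite weighted simplicial complex with coefficients in $R$, and let $n\ge0$. Let $(K,M)$ be a distinguished $\kappa/\mu$-bipartition of the $n$-simplices of $X$ and let $(K',M')$ be a distinguished $\kappa/\mu$-bipartition of the $(n+1)$-simplices of $X$; put $p=|K|$. Let $T^v_n$ be the torsion submodule of $H^v_n(X)$. Then there is a decomposition $H^v_n(X)=F^v_n\oplus T^v_n$ with $F^v_n$ a free submodule, and a bipartition $K=\{\kappa^n_1,\dots,\kappa^n_q\}\,\dot\cup\,\{\kappa^n_{q+1},\dots,\kappa^n_p\}$, such that there is an exact sequence $$0\to H_n(X,R)\xrightarrow{\ \bar\theta_n\ }F^v_n\xrightarrow{\ j\ }\bigoplus_{s=1}^{q}R/(v(\kappa^n_s))\to0.$$ Furthermore, $\mathrm{rnk}_R(H^v_n(X))=\mathrm{rnk}_{\mathbb{F}}(H_n(X,\mathbb{F}))$, and, writing $M'=\{\mu^{n+1}_{q+1},\dots,\mu^{n+1}_{p}\}$ (in particular $|M'|=p-q$), there is a permutation $\alpha$ of $\{q+1,\dots,p\}$, establishing a pairing between the simplices $\kappa^n_s$ and $\mu^{n+1}_{\alpha(s)}$ of dimensions $n$ and $n+1$, such that $v(\mu^{n+1}_{\alpha(s)})$ divides $v(\kappa^n_s)$ for all $q+1\le s\le p$ and $$T^v_n\cong\bigoplus_{s=q+1}^{p}R\big/\big(v(\kappa^n_s)/v(\mu^{n+1}_{\alpha(s)})\big).$$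
   Context: A weighted simplicial complex $(X,\omega)$ is a simplicial complex $X$ with a function $\omega\colon X\to\mathbb{N}=\{0,1,2,\dots\}$ on its simplices such that $\sigma\subseteq\tau$ implies $\omega(\sigma)\ge\omega(\tau)$. With $v(\sigma)=\pi^{\omega(\sigma)}\in R$ one also writes $(X,v)$. Fix a total order on the vertices of $X$, and for an $n$-simplex $\sigma$ let $\hat\sigma_i$ be its $i$-th face. $C_n(X,R)$ is the free $R$-module on the $n$-simplices of $X$, with weighted boundary map $\partial_n^v(\sigma)=\sum_{i=0}^n(-1)^i\frac{v(\hat\sigma_i)}{v(\sigma)}\hat\sigma_i=\sum_{i=0}^n(-1)^i\pi^{\omega(\hat\sigma_i)-\omega(\sigma)}\hat\sigma_i$ for $n\ge1$, and $\partial_0^v=0$. The weighted homology is $H_n^v(X)=\ker\partial_n^v/\mathrm{Im}\,\partial_{n+1}^v$. $H_n(X,A)$ denotes ordinary simplicial homology with coefficients in $A$. The map $\bar\theta_n\colon H_n(X,R)\to H^v_n(X)$ is induced by the $R$-linear chain map $\theta_n(\sigma)=v(\sigma)\sigma$ from the ordinary simplicial chain complex to the weighted one. Distinguished $\kappa/\mu$-bipartition of the $m$-simplices: a partition of the set of $m$-simplices of $X$ into two sets $K$ (the $\kappa$-simplices) and $M$ (the $\mu$-simplices) such that $\{\partial^v_m(\mu)\mid\mu\in M\}$ is a basis of $\partial^v_m(C_m(X,R))$ and there is a basis $\{\hat\beta_\kappa\mid\kappa\in K\}$ of $\ker\partial^v_m$ with $\hat\beta_\kappa=\sum_\ell r_\ell\mu_\ell+\kappa$,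 where $\mu_\ell\in M$ and each nonzero $r_\ell$ is a monomial $x\pi^k$ ($x\in\mathbb{F}\setminus\{0\}$, $k\ge0$) with $k+\omega(\kappa)=\omega(\mu_\ell)$. Such bipartitions exist for every $m$. *)

(* Defs.v *)
From HB Require Import structures.
From mathcomp Require Import all_boot all_order all_algebra all_fingroup.
From mathcomp Require Import generic_quotient ring_quotient.
From mathcomp Require Import boolp.

Set Implicit Arguments.
Unset Strict Implicit.
Unset Printing Implicit Defensive.

Import Order.TTheory GRing.Theory.

Local Open Scope ring_scope.
Local Open Scope quotient_scope.

Record fps (A : Type) : Type := Fps { coefs : nat -> A }.

HB.instance Definition _ (A : Type) := gen_eqMixin (fps A).
HB.instance Definition _ (A : Type) := gen_choiceMixin (fps A).

Lemma fpsP (A : Type) (f g : fps A) : coefs f =1 coefs g <-> f = g.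
Proof.
split=> [|-> //]; case: f g => [f] [g] /= fg; congr Fps; exact/funext.
Qed.

(* The ring operations are locked to keep unification from unfolding them. *)
HB.lock Definition fps_opp (A : comNzRingType) (f : fps A) : fps A :=
  Fps (fun n => - coefs f n).
HB.lock Definition fps_add (A : comNzRingType) (f g : fps A) : fps A :=
  Fps (fun n => coefs f n + coefs g n).
HB.lock Definition fps_mul (A : comNzRingType) (f g : fps A) : fps A :=
  Fps (fun n => \sum_(i < n.+1) coefs f i * coefs g (n - i)).
HB.lock Definition fpsC (A : comNzRingType) (a : A) : fps A :=
  Fps (fun n => if n == 0%N then a else 0).
HB.lock Definition fps_var (A : comNzRingType) : fps A :=
  Fps (fun n => (n == 1%N)%:R).

Section FpsRing.
Variable A : comNzRingType.
Implicit Types f g h : fps A.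

Let addE f g n : coefs (fps_add f g) n = coefs f n + coefs g n.
Proof. by rewrite fps_add.unlock. Qed.
Let mulE f g n :
  coefs (fps_mul f g) n = \sum_(i < n.+1) coefs f i * coefs g (n - i).
Proof. by rewrite fps_mul.unlock. Qed.

Lemma coefs_fpsC (a : A) n : coefs (fpsC a) n = if n == 0%N then a else 0.
Proof. by rewrite fpsC.unlock. Qed.

Fact fps_addA : associative (@fps_add A).
Proof. by move=> f g h; apply/fpsP => n; rewrite !addE addrA. Qed.
Fact fps_addC : commutative (@fps_add A).
Proof. by move=> f g; apply/fpsP => n; rewrite !addE addrC. Qed.
Fact fps_add0 : left_id (fpsC 0) (@fps_add A).
Proof.
by move=> f; apply/fpsP => n; rewrite addE coefs_fpsC; case: eqP; rewrite add0r.
Qed.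
Fact fps_addN : left_inverse (fpsC 0) (@fps_opp A) (@fps_add A).
Proof.
move=> f; apply/fpsP => n; rewrite addE coefs_fpsC fps_opp.unlock /= addNr.
by case: eqP.
Qed.

HB.instance Definition _ :=
  GRing.isZmodule.Build (fps A) fps_addA fps_addC fps_add0 fps_addN.

(* [fps_trunc N f] is [f] modulo degree [N]; it transports the ring laws
   from polynomials. *)
Let fps_trunc N f : {poly A} := \poly_(i < N) coefs f i.

Let mul_trunc N n f g : (n < N)%N ->
  coefs (fps_mul f g) n = (fps_trunc N f * fps_trunc N g)`_n.
Proof.
move=> ltnN; rewrite mulE coefM; apply: eq_bigr => i _; rewrite !coef_poly.
rewrite (leq_trans (ltn_ord i) ltnN).
by rewrite (leq_ltn_trans (leq_subr _ _) ltnN).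
Qed.

Fact fps_mulC : commutative (@fps_mul A).
Proof.
by move=> f g; apply/fpsP => n; rewrite !(mul_trunc _ _ (ltnSn n)) mulrC.
Qed.

Fact fps_mulA : associative (@fps_mul A).
Proof.
move=> f g h; apply/fpsP => n.
have -> : coefs (fps_mul f (fps_mul g h)) n =
    (fps_trunc n.+1 f * (fps_trunc n.+1 g * fps_trunc n.+1 h))`_n.
  rewrite mulE coefM; apply: eq_bigr => i _; rewrite coef_poly ltn_ord.
  by rewrite -(@mul_trunc n.+1 (n - i)) // ltnS leq_subr.
have -> : coefs (fps_mul (fps_mul f g) h) n =
    ((fps_trunc n.+1 f * fps_trunc n.+1 g) * fps_trunc n.+1 h)`_n.
  rewrite mulE coefM; apply: eq_bigr => i _; rewrite coef_poly ltnS leq_subr.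
  by rewrite -(@mul_trunc n.+1 i) // ltn_ord.
by rewrite mulrA.
Qed.

Fact fps_mul1 : left_id (fpsC 1) (@fps_mul A).
Proof.
move=> f; apply/fpsP => n; rewrite mulE big_ord_recl coefs_fpsC mul1r subn0.
by rewrite big1 ?addr0 // => i _; rewrite coefs_fpsC mul0r.
Qed.

Fact fps_mulDl : left_distributive (@fps_mul A) (@fps_add A).
Proof.
move=> f g h; apply/fpsP => n; rewrite addE !mulE -big_split /=.
by apply: eq_bigr => i _; rewrite addE mulrDl.
Qed.

Fact fps_1neq0 : fpsC 1 != 0 :> fps A.
Proof.
apply/eqP => /(congr1 (@coefs A)) /(congr1 (@^~ 0%N)) /eqP.
by rewrite !coefs_fpsC oner_eq0.
Qed.

HB.instance Definition _ := GRing.Zmodule_isComNzRing.Build (fps A)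
  fps_mulA fps_mulC fps_mul1 fps_mulDl fps_1neq0.

Definition fps_unit : {pred fps A} := fun f => `[< exists g, g * f = 1 >].
Definition fps_inv f : fps A :=
  if pselect (exists g, g * f = 1) is left e then projT1 (cid e) else f.

Fact fps_mulV : {in fps_unit, left_inverse 1 fps_inv *%R}.
Proof.
move=> f /asboolP uf; rewrite /fps_inv; case: pselect => // e.
exact: projT2 (cid e).
Qed.
Fact fps_unitP f g : g * f = 1 -> fps_unit f.
Proof. by move=> gf; apply/asboolP; exists g. Qed.
Fact fps_inv_out : {in [predC fps_unit], fps_inv =1 id}.
Proof.
move=> f; rewrite inE => /asboolPn nuf; rewrite /fps_inv.
by case: pselect.
Qed.

HB.instance Definition _ := GRing.ComNzRing_hasMulInverse.Build (fps A)
  fps_mulV fps_unitP fps_inv_out.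

Lemma coefs0 n : coefs (0 : fps A) n = 0.
Proof. by rewrite coefs_fpsC if_same. Qed.
Lemma coefs1 n : coefs (1 : fps A) n = (n == 0%N)%:R.
Proof. by rewrite coefs_fpsC; case: eqP. Qed.
Lemma coefsN f n : coefs (- f) n = - coefs f n.
Proof. by rewrite -[- f]/(fps_opp f) fps_opp.unlock. Qed.
Lemma coefsD f g n : coefs (f + g) n = coefs f n + coefs g n.
Proof. exact: addE. Qed.
Lemma coefsM f g n :
  coefs (f * g) n = \sum_(i < n.+1) coefs f i * coefs g (n - i).
Proof. exact: mulE. Qed.
Lemma coefs_var n : coefs (fps_var A) n = (n == 1%N)%:R.
Proof. by rewrite fps_var.unlock. Qed.

End FpsRing.

Section FpsDomain.
Variable A : idomainType.

Fact fps_integral (f g : fps A) : f * g = 0 -> (f == 0) || (g == 0).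
Proof.
move=> fg0; apply/orP; case: (pselect (f = 0)) => [->|f0]; first by left.
case: (pselect (g = 0)) => [->|g0]; first by right.
have order (h : fps A) : h <> 0 ->
    {i | coefs h i != 0 & forall j, (j < i)%N -> coefs h j = 0}.
  move=> h0; have ex : exists i, coefs h i != 0.
    apply: contrapT => nex; apply: h0; apply/fpsP => i; rewrite coefs0.
    by apply: contrapT => hi; apply: nex; exists i; apply/eqP.
  exists (ex_minn ex); case: ex_minnP => // i _ mini j ltji.
  by apply/eqP; apply: contraTT ltji => /mini; rewrite -leqNgt.
have [i fi fmin] := order f f0; have [j gj gmin] := order g g0.
exfalso; have := congr1 (fun h => coefs h (i + j)) fg0; rewrite /= coefsM coefs0.
have lti : (i < (i + j).+1)%N by rewrite ltnS leq_addr.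
rewrite (bigD1 (Ordinal lti)) //= addKn big1 => [|k neki].
  by rewrite addr0 => /eqP; rewrite mulf_eq0 (negPf fi) (negPf gj).
have [ltki|ltik|eqki] := ltngtP k i; first by rewrite fmin ?mul0r.
  rewrite gmin ?mulr0 //; have := ltn_ord k; rewrite ltnS => le.
  by rewrite ltn_subLR // ltn_add2r.
by move: neki; rewrite -val_eqE /= eqki eqxx.
Qed.

HB.instance Definition _ :=
  GRing.ComUnitRing_isIntegral.Build (fps A) fps_integral.

End FpsDomain.

Notation "{ 'fps' A }" := (fps A) (format "{ 'fps'  A }") : type_scope.

Section Submodules.
Variables (R : comNzRingType) (U : lmodType R).

Section SubQuot.
Variable S : submodClosed U.

Record submod : Type := Submod { submod_val :> U; _ : submod_val \in S }.

HB.instance Definition _ := [isSub for submod_val].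
HB.instance Definition _ := [Choice of submod by <:].
HB.instance Definition _ := [SubChoice_isSubLmodule of submod by <:].

(* [ring_quotient] divides by a [zmodClosed] predicate, which [submodClosed]
   does not extend. *)
Definition zmod_pred : {pred U} := fun x => x \in S.

Fact zmod_pred_closed : zmod_closed zmod_pred.
Proof.
split; first exact: rpred0.
move=> x y Sx Sy; rewrite /zmod_pred -scaleN1r; apply: rpredD => //.
exact: rpredZ.
Qed.

HB.instance Definition _ := GRing.isZmodClosed.Build U zmod_pred zmod_pred_closed.

Definition quotmod : Type := Quotient.quot zmod_pred.

HB.instance Definition _ := GRing.Zmodule.on quotmod.
HB.instance Definition _ := Quotient.on quotmod.

Definition proj (x : U) : quotmod := \pi x.

Lemma proj_eq x y : (proj x == proj y) = (x - y \in S).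
Proof. by rewrite -[RHS]/(x - y \in zmod_pred) Quotient.idealrBE. Qed.

Lemma projK (y : quotmod) : proj (repr y) = y. Proof. exact: reprK. Qed.

Lemma projD x y : proj (x + y) = proj x + proj y.
Proof. exact: Quotient.pi_add. Qed.

Definition quotmod_scale (a : R) (y : quotmod) : quotmod := proj (a *: repr y).

Lemma projZ a x : proj (a *: x) = quotmod_scale a (proj x).
Proof.
apply/eqP; rewrite proj_eq -scalerBr; apply: rpredZ.
by rewrite -proj_eq projK.
Qed.

Fact quotmod_scaleA a b y :
  quotmod_scale a (quotmod_scale b y) = quotmod_scale (a * b) y.
Proof. by rewrite -[y]projK -!projZ scalerA. Qed.
Fact quotmod_scale1 : left_id 1 quotmod_scale.
Proof. by move=> y; rewrite -[y]projK -projZ scale1r. Qed.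
Fact quotmod_scaleDr : right_distributive quotmod_scale +%R.
Proof.
by move=> a x y; rewrite -[x]projK -[y]projK -projD -!projZ scalerDr projD.
Qed.
Fact quotmod_scaleDl y : {morph quotmod_scale^~ y : a b / a + b}.
Proof. by move=> a b; rewrite -[y]projK -!projZ scalerDl projD. Qed.

HB.instance Definition _ := GRing.Zmodule_isLmodule.Build R quotmod
  quotmod_scaleA quotmod_scale1 quotmod_scaleDr quotmod_scaleDl.

Fact proj_is_linear : linear proj.
Proof. by move=> a x y; rewrite projD projZ. Qed.
HB.instance Definition _ := GRing.isLinear.Build R U quotmod _ proj proj_is_linear.

End SubQuot.

Definition internal_direct_sum (S T : submodClosed U) : Prop :=
  (forall x, exists2 s, s \in S & exists2 t, t \in T & x = s + t) /\
  (forall x, x \in S -> x \in T -> x = 0).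

End Submodules.

Section DirectSum.
Variables (R : comNzRingType) (I : finType) (U : I -> lmodType R).

Definition dirsum : Type := {dffun forall i, U i}.

HB.instance Definition _ := Choice.on dirsum.

Definition dirsum_zero : dirsum := [ffun i => 0 : U i].
Definition dirsum_opp (x : dirsum) : dirsum := [ffun i => - x i : U i].
Definition dirsum_add (x y : dirsum) : dirsum := [ffun i => x i + y i : U i].
Definition dirsum_scale (a : R) (x : dirsum) : dirsum :=
  [ffun i => a *: x i : U i].

Fact dirsum_addA : associative dirsum_add.
Proof. by move=> x y z; apply/ffunP => i; rewrite !ffunE addrA. Qed.
Fact dirsum_addC : commutative dirsum_add.
Proof. by move=> x y; apply/ffunP => i; rewrite !ffunE addrC. Qed.
Fact dirsum_add0 : left_id dirsum_zero dirsum_add.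
Proof. by move=> x; apply/ffunP => i; rewrite !ffunE add0r. Qed.
Fact dirsum_addN : left_inverse dirsum_zero dirsum_opp dirsum_add.
Proof. by move=> x; apply/ffunP => i; rewrite !ffunE addNr. Qed.

HB.instance Definition _ := GRing.isZmodule.Build dirsum
  dirsum_addA dirsum_addC dirsum_add0 dirsum_addN.

Fact dirsum_scaleA a b x :
  dirsum_scale a (dirsum_scale b x) = dirsum_scale (a * b) x.
Proof. by apply/ffunP => i; rewrite !ffunE scalerA. Qed.
Fact dirsum_scale1 : left_id 1 dirsum_scale.
Proof. by move=> x; apply/ffunP => i; rewrite !ffunE scale1r. Qed.
Fact dirsum_scaleDr : right_distributive dirsum_scale +%R.
Proof. by move=> a x y; apply/ffunP => i; rewrite !ffunE scalerDr. Qed.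
Fact dirsum_scaleDl x : {morph dirsum_scale^~ x : a b / a + b}.
Proof. by move=> a b; apply/ffunP => i; rewrite !ffunE scalerDl. Qed.

HB.instance Definition _ := GRing.Zmodule_isLmodule.Build R dirsum
  dirsum_scaleA dirsum_scale1 dirsum_scaleDr dirsum_scaleDl.

End DirectSum.

Section Cyclic.
Variables (R : comNzRingType) (a : R).

Definition multiples : {pred R^o} := fun x => `[< exists c : R, x = c * a >].

Fact multiples_closed : subsemimod_closed multiples.
Proof.
split; first split=> [|x y /asboolP[c ->] /asboolP[d ->]].
- by apply/asboolP; exists 0; rewrite mul0r.
- by apply/asboolP; exists (c + d); rewrite mulrDl.
by move=> b x /asboolP[c ->]; apply/asboolP; exists (b * c); rewrite -mulrA.
Qed.

HB.instance Definition _ := GRing.isSubmodClosed.Build R R^o multiples multiples_closed.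

(* [R/(a)] as an [R]-module. *)
Definition cyclic_mod : lmodType R := quotmod multiples.

End Cyclic.

Section Bases.
Variables (R : comNzRingType) (U : lmodType R).

Definition lin_indep (I : finType) (B : {set I}) (b : I -> U) : Prop :=
  forall c : I -> R, \sum_(i in B) c i *: b i = 0 -> forall i, i \in B -> c i = 0.

Definition is_basis (I : finType) (B : {set I}) (b : I -> U) (S : {pred U}) : Prop :=
  [/\ forall i, i \in B -> b i \in S,
      lin_indep B b
    & forall x, x \in S -> exists c : I -> R, x = \sum_(i in B) c i *: b i].

(* Only finitely generated modules occur, so free means having a finite basis. *)
Definition is_free : Prop :=
  exists (r : nat) (b : 'I_r -> U), is_basis [set: 'I_r] b predT.

Definition has_rank (r : nat) : Prop :=
  (exists b : 'I_r -> U, lin_indep [set: 'I_r] b) /\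
  (forall (s : nat) (b : 'I_s -> U), lin_indep [set: 'I_s] b -> (s <= r)%N).

End Bases.

Section Torsion.
Variables (R : idomainType) (U : lmodType R).

Definition torsion : {pred U} :=
  fun x => `[< exists2 a : R, a != 0 & a *: x = 0 >].

Fact torsion_closed : subsemimod_closed torsion.
Proof.
split; first split=> [|x y /asboolP[a a0 ax] /asboolP[b b0 bx]].
- by apply/asboolP; exists 1; rewrite ?oner_eq0 ?scaler0.
- apply/asboolP; exists (a * b); first by rewrite mulf_neq0.
  by rewrite scalerDr {1}mulrC -!scalerA ax bx !scaler0 addr0.
move=> c x /asboolP[a a0 ax]; apply/asboolP; exists a => //.
by rewrite scalerA mulrC -scalerA ax scaler0.
Qed.

HB.instance Definition _ := GRing.isSubmodClosed.Build R U torsion torsion_closed.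

End Torsion.
Arguments torsion {R} U.

Section Maps.
Variable R : comNzRingType.

Definition lin_iso (U W : lmodType R) : Prop :=
  exists f : {linear U -> W}, bijective f.

(* [0 -> U -f-> W -g-> Z -> 0] is exact. *)
Definition short_exact (U W Z : lmodType R)
    (f : {linear U -> W}) (g : {linear W -> Z}) : Prop :=
  [/\ injective f, forall y, g y = 0 <-> (exists x, f x = y)
    & forall z, exists y, g y = z].

Section KernelImage.
Variables (U W : lmodType R) (f : {linear U -> W}).

Definition lin_ker : {pred U} := fun x => f x == 0.
Definition lin_im : {pred W} := fun y => `[< exists x, f x = y >].

Fact lin_ker_closed : subsemimod_closed lin_ker.
Proof.
split; first split=> [|x y /eqP fx /eqP fy].
- by apply/eqP; rewrite linear0.
- by apply/eqP; rewrite linearD fx fy addr0.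
by move=> a x /eqP fx; apply/eqP; rewrite linearZ /= fx scaler0.
Qed.

HB.instance Definition _ := GRing.isSubmodClosed.Build R U lin_ker lin_ker_closed.

End KernelImage.

Section Homology.
Variables (U W Z : lmodType R) (f : {linear U -> W}) (g : {linear W -> Z}).

(* The image of [f] as a submodule of the kernel of [g], for [g \o f = 0];
   in general, its intersection with that kernel. *)
Definition im_in_ker : {pred submod (lin_ker g)} := fun z => val z \in lin_im f.

Fact im_in_ker_closed : subsemimod_closed im_in_ker.
Proof.
split; first split=> [|x y /asboolP[u fu] /asboolP[w fw]].
- by apply/asboolP; exists 0; rewrite linear0.
- by apply/asboolP; exists (u + w); rewrite linearD fu fw.
by move=> a x /asboolP[u fu]; apply/asboolP; exists (a *: u); rewrite linearZ /= fu.
Qed.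

HB.instance Definition _ :=
  GRing.isSubmodClosed.Build R (submod (lin_ker g)) im_in_ker im_in_ker_closed.

Definition homology : lmodType R := quotmod im_in_ker.

End Homology.
Arguments im_in_ker {U W Z} f g.

Section HomologyMap.
Variables (U W Z U' W' Z' : lmodType R).
Variables (f : {linear U -> W}) (g : {linear W -> Z}).
Variables (f' : {linear U' -> W'}) (g' : {linear W' -> Z'}).
Variables (hU : {linear U -> U'}) (hW : {linear W -> W'}) (hZ : {linear Z -> Z'}).
Hypotheses (hf : forall x, f' (hU x) = hW (f x))
           (hg : forall x, g' (hW x) = hZ (g x)).

Fact ker_map_subproof (z : submod (lin_ker g)) : hW (val z) \in lin_ker g'.
Proof. by case: z => z /= /eqP gz; apply/eqP; rewrite hg gz linear0. Qed.

Definition ker_map (z : submod (lin_ker g)) : submod (lin_ker g') :=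
  Submod (ker_map_subproof z).

(* The class of a cycle [z] is sent to the class of [hW z]: see
   [homology_map_proj]. *)
Definition homology_map_fun (x : quotmod (im_in_ker f g)) :
  quotmod (im_in_ker f' g') := proj _ (ker_map (repr x)).

Lemma homology_map_proj z :
  homology_map_fun (proj _ z) = proj _ (ker_map z).
Proof.
apply/eqP; rewrite proj_eq.
have /asboolP[c fc] : repr (proj (im_in_ker f g) z) - z \in im_in_ker f g.
  by rewrite -proj_eq projK.
by apply/asboolP; exists (hU c); rewrite hf fc /= linearB.
Qed.

Fact homology_map_is_linear : linear homology_map_fun.
Proof.
move=> a x y; rewrite -[x]projK -[y]projK -linearP !homology_map_proj -linearP.
by congr (proj _ _); apply: val_inj; rewrite /= linearP.
Qed.

HB.instance Definition _ := GRing.isLinear.Build R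
  (quotmod (im_in_ker f g)) (quotmod (im_in_ker f' g')) _
  homology_map_fun homology_map_is_linear.

Definition homology_map : {linear homology f g -> homology f' g'} :=
  homology_map_fun.

End HomologyMap.

End Maps.
Arguments im_in_ker {R U W Z} f g.

Section Complexes.
Context {disp : Order.disp_t}.

(* The order of [V] is the total order on the vertices; elements of [V] that
   lie in no simplex are not vertices of the complex. *)
Record wcomplex (V : finOrderType disp) : Type := WComplex {
  simplices :> {set {set V}};
  weight : {set V} -> nat;  (* only its values on [simplices] matter *)
  simplices_neq0 : set0 \notin simplices;
  simplices_sub : forall s t : {set V},
    s \in simplices -> t \subset s -> t != set0 -> t \in simplices;
  weight_anti : forall s t : {set V},
    s \in simplices -> t \in simplices -> s \subset t -> (weight t <= weight s)%N
}.

Context {V : finOrderType disp}.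
Variable X : wcomplex V.

Definition simplex (n : nat) : Type :=
  {s : {set V} | (s \in simplices X) && (#|s| == n.+1)}.
HB.instance Definition _ n := Finite.on (simplex n).
HB.instance Definition _ n := SubType.on (simplex n).

(* [s] without its [i]-th vertex, counting from 0 in increasing order. *)
Definition del_vertex (s : {set V}) (i : nat) : {set V} :=
  [set x in s | index x (Order.enum s) != i].

Lemma card_del_vertex (s : {set V}) i :
  (i < #|s|)%N -> #|del_vertex s i| = #|s|.-1.
Proof.
move=> lti; have lti' : (i < size (Order.enum s))%N by rewrite -Order.cardE.
have x0 : V by case: (Order.enum s) lti'.
have us : uniq (Order.enum s) by exact: Order.enum_uniq.
have xs : nth x0 (Order.enum s) i \in s by rewrite -Order.mem_enum mem_nth.
suff -> : del_vertex s i = s :\ nth x0 (Order.enum s) i.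
  by rewrite [in RHS](cardsD1 (nth x0 (Order.enum s) i) s) xs.
apply/setP => x; rewrite !inE andbC; have [sx|] := boolP (x \in s); last by rewrite !andbF.
rewrite !andbT; congr (~~ _); apply/eqP/eqP => [<-|->]; last by rewrite index_uniq.
by rewrite nth_index // Order.mem_enum.
Qed.

Fact face_subproof n (s : simplex n.+1) (i : 'I_n.+2) :
  (del_vertex (val s) i \in simplices X) && (#|del_vertex (val s) i| == n.+1).
Proof.
case/andP: (valP s) => Xs /eqP cs.
have cd : #|del_vertex (val s) i| = n.+1 by rewrite card_del_vertex cs.
rewrite cd eqxx andbT; apply: (simplices_sub Xs).
  by apply/subsetP => x; rewrite inE => /andP[].
by rewrite -card_gt0 cd.
Qed.

Definition face n (s : simplex n.+1) (i : 'I_n.+2) : simplex n :=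
  exist _ (del_vertex (val s) i) (face_subproof s i).

Section Chains.
Variable A : comNzRingType.

Definition chain (n : nat) : lmodType A := {ffun simplex n -> A^o}.

Definition gen n (s : simplex n) : chain n := [ffun t => (t == s)%:R].

Lemma chain_scaleE n a (c : chain n) s : (a *: c) s = a * c s.
Proof. by rewrite ffunE. Qed.

Lemma genE n (s t : simplex n) : gen s t = (t == s)%:R.
Proof. by rewrite ffunE. Qed.

Section Boundary.
(* [e t s] is the extra coefficient of the face [t] in the boundary of [s]. *)
Variable e : {set V} -> {set V} -> A.

Definition boundaryS n (c : chain n.+1) : chain n :=
  \sum_(s : simplex n.+1) c s *:
    \sum_(i < n.+2) ((-1) ^+ i * e (val (face s i)) (val s)) *: gen (face s i).

(* The boundary of 0-chains is 0; since [0.-1] is [0], its target is immaterial. *)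
Definition boundary_fun (n : nat) : chain n -> chain n.-1 :=
  if n is m.+1 then @boundaryS m else fun=> 0.

Fact boundary_is_linear n : linear (@boundary_fun n).
Proof.
case: n => [|n] a x y /=; first by rewrite scaler0 addr0.
rewrite /boundaryS scaler_sumr -big_split /=; apply: eq_bigr => s _.
by rewrite !ffunE scalerDl -scalerA.
Qed.

HB.instance Definition _ n :=
  GRing.isLinear.Build A (chain n) (chain n.-1) _ (@boundary_fun n)
    (@boundary_is_linear n).

Definition boundary n : {linear chain n -> chain n.-1} := @boundary_fun n.

End Boundary.

Definition sboundary n : {linear chain n -> chain n.-1} :=
  boundary (fun _ _ => 1) n.

(* Ordinary simplicial homology with coefficients in [A]. *)
Definition shomology n : lmodType A := homology (sboundary n.+1) (sboundary n).

End Chains.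

Section Weighted.
Variable F : fieldType.
Local Notation R := {fps F}.

Definition vwt (s : {set V}) : R := fps_var F ^+ weight X s.

(* [vwt s / vwt t], for [weight X t <= weight X s]. *)
Definition vwt_div (s t : {set V}) : R :=
  fps_var F ^+ (weight X s - weight X t).

Lemma vwt_divK s t : (weight X t <= weight X s)%N -> vwt_div s t * vwt t = vwt s.
Proof. by move=> le; rewrite /vwt_div /vwt -exprD subnK. Qed.

Definition wboundary n : {linear chain R n -> chain R n.-1} :=
  boundary vwt_div n.

Definition whomology n : lmodType R := homology (wboundary n.+1) (wboundary n).

Section Theta.
Variable n : nat.

Definition theta_fun (c : chain R n) : chain R n := [ffun s => vwt (val s) * c s].

Fact theta_is_linear : linear theta_fun.
Proof.
by move=> a x y; apply/ffunP => s; rewrite !ffunE mulrDr /= mulrCA.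
Qed.

HB.instance Definition _ :=
  GRing.isLinear.Build R (chain R n) (chain R n) _ theta_fun theta_is_linear.

Definition theta : {linear chain R n -> chain R n} := theta_fun.

Lemma thetaE c s : theta c s = vwt (val s) * c s.
Proof. exact: ffunE. Qed.

End Theta.

Lemma theta_gen n (s : simplex n) : theta n (gen R s) = vwt (val s) *: gen R s.
Proof.
apply/ffunP => t; rewrite [LHS]thetaE [RHS]chain_scaleE !genE.
by have [->|_] := eqVneq t s; rewrite ?mulr0.
Qed.

Lemma theta_chain_map n c : wboundary n (theta n c) = theta n.-1 (sboundary R n c).
Proof.
case: n c => [|n] c; first by rewrite [RHS]raddf0.
rewrite [RHS](raddf_sum (theta n)); apply: eq_bigr => s _.
rewrite [RHS]linearZ_LR; apply: (etrans (congr1 (fun a => a *: _) (thetaE c s))).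
rewrite mulrC -scalerA; apply: (congr1 (fun x => c s *: x)).
rewrite scaler_sumr [RHS](raddf_sum (theta n)); apply: eq_bigr => i _.
rewrite [RHS]linearZ_LR theta_gen !scalerA mulr1 mulrCA; congr (_ * _ *: _).
rewrite mulrC vwt_divK //; apply: weight_anti.
- by case/andP: (valP (face s i)).
- by case/andP: (valP s).
by apply/subsetP => x; rewrite inE => /andP[].
Qed.

Definition theta_bar n : {linear shomology R n -> whomology n} :=
  homology_map (@theta_chain_map n.+1) (@theta_chain_map n).

Definition distinguished (m : nat) (K M : {set simplex m}) : Prop :=
  [/\ K :|: M = setT, [disjoint K & M],
      is_basis M (fun s => wboundary m (gen R s)) (lin_im (wboundary m))
    & exists2 b : simplex m -> chain R m,
        is_basis K b (lin_ker (wboundary m))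
      & forall s, s \in K -> exists2 r : simplex m -> R,
          b s = \sum_(t in M) r t *: gen R t + gen R s
        & forall t, t \in M -> r t != 0 -> exists x : F, exists k : nat,
            [/\ x != 0, r t = fpsC x * fps_var F ^+ k
              & (k + weight X (val s))%N = weight X (val t)] ].

End Weighted.

End Complexes.

Definition enumerates (T : finType) (m : nat) (f : 'I_m -> T) (B : {set T}) : Prop :=
  injective f /\ B = [set f i | i : 'I_m].

(* Main.v *)
Require Import Defs.
From HB Require Import structures.
From mathcomp Require Import all_boot all_order all_algebra all_fingroup.
From mathcomp Require Import boolp zify.

Set Implicit Arguments.
Unset Strict Implicit.
Unset Printing Implicit Defensive.

Import GRing.Theory.
Local Open Scope ring_scope.

(** Write [w s] for the weight of a simplex, [pi] for the variable and [v s] for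
[pi ^+ w s].  The identity [d^v (theta c) = theta (d c)] says that, once [pi] is
inverted, the weighted complex is the ordinary one in the rescaled basis
[v s *: s].  Every vector in sight is therefore homogeneous: it is determined by a
chain over [F] and one integer, the exponent of [pi] on a simplex [s] being [w s]
minus that integer ([lift_chain], [boundary_lift]).  So the theorem reduces to linear
algebra over [F] in which every operation has to respect the weights.

A distinguished bipartition provides chains [b k] over [F], [k] in [K], whose lifts
form a basis of the weighted cycles ([distinguished_cycles]); the coordinate of a
cycle [z] on the lift of [b k] is its coefficient [z k] ([cycle_ofK]).  The boundaries
are generated by those of the simplices [mu] in [M'] ([distinguished_span]), so in
these coordinates they form the row space of the matrix
[a mu k * pi ^+ (w k - w mu)], where [a mu k] is the incidence number of [mu] and [k].
Add to a row only multiples of rows of greater or equal weight, process the rows by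
decreasing weight and pivot on a lightest column: Gaussian elimination then only
uses operations that lift to invertible matrices over [R].  It produces an
injection [f] from [M'] to [K] with [w mu <= w (f mu)] and a basis of the cycles
for which the boundaries are spanned by the multiples [pi ^+ (w (f mu) - w mu)] of
the basis vectors of index [f mu] ([graded_normal_form], [scale_mx_row_space]).

The same change of basis, with [pi] replaced by [1], presents the ordinary homology
over [R] and over [F], where the multiples become the basis vectors
themselves ([homology_presents]).  In these presentations [theta] multiplies the
coordinate of index [k] by [v k] ([theta_cycle]).  All assertions can now be read
off ([presented_exact], [torsion_iso], [presented_rank]): the free part is spanned by
the basis vectors outside the image of [f], the torsion is the sum of the
[R / (pi ^+ (w (f mu) - w mu))], and [f] is the pairing. *)

(** * Normal form of graded matrices *)

Lemma sum_neq0 (A : nmodType) (I : finType) (a : I -> A) :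
  \sum_i a i != 0 -> exists i, a i != 0.
Proof.
move=> sum0; apply/existsP; apply: contraNT sum0; rewrite negb_exists.
by move=> /forallP a0; rewrite big1 // => i _; apply/eqP; rewrite -[_ == _]negbK.
Qed.

Section GradedMatrices.
Variable F : fieldType.

(** Row [i] sits in degree [u i] and column [j] in degree [w j]; the condition says
    that the entries [A i j * pi ^+ (w j - u i)] of the corresponding homogeneous
    matrix over power series have no negative exponent. *)
Definition graded m k (u : 'I_m -> nat) (w : 'I_k -> nat) (A : 'M[F]_(m, k)) :=
  forall i j, A i j != 0 -> (u i <= w j)%N.

Lemma gradedM m k l u w x (A : 'M_(m, k)) (B : 'M_(k, l)) :
  graded u w A -> graded w x B -> graded u x (A *m B).
Proof.
move=> gA gB i j; rewrite mxE => /sum_neq0[l0].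
by rewrite mulf_eq0 negb_or => /andP[/gA uw /gB]; apply: leq_trans.
Qed.

Lemma graded1 k (w : 'I_k -> nat) : graded w w 1%:M.
Proof.
by move=> i j; rewrite mxE; case: (eqVneq i j) => [->|_]; rewrite ?eqxx.
Qed.

Definition graded_inverse k (w : 'I_k -> nat) (G G' : 'M[F]_k) :=
  [/\ graded w w G, graded w w G', G *m G' = 1%:M & G' *m G = 1%:M].

Lemma graded_inverse1 k (w : 'I_k -> nat) : graded_inverse w 1%:M 1%:M.
Proof. by split; rewrite ?mulmx1 //; apply: graded1. Qed.

Lemma graded_inverseM k (w : 'I_k -> nat) G G' H H' :
  graded_inverse w G G' -> graded_inverse w H H' ->
  graded_inverse w (G *m H) (H' *m G').
Proof.
move=> [gG gG' GG' G'G] [gH gH' HH' H'H].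
split; [exact: gradedM gH | exact: gradedM gG' | |].
  by rewrite mulmxA -(mulmxA G) HH' mulmx1.
by rewrite mulmxA -(mulmxA H') G'G mulmx1.
Qed.

Definition replace_row k (i : 'I_k) (y : 'rV[F]_k) : 'M_k :=
  \matrix_(a, b) if a == i then y 0 b else (a == b)%:R.

Lemma row_replace_row k i (y : 'rV[F]_k) l (B : 'M_(k, l)) a :
  row a (replace_row i y *m B) = if a == i then y *m B else row a B.
Proof.
rewrite row_mul; case: ifP => ai.
  by have -> : row a (replace_row i y) = y by apply/rowP => b; rewrite !mxE ai.
have -> : row a (replace_row i y) = delta_mx 0 a.
  by apply/rowP => b; rewrite !mxE ai eqxx eq_sym.
by rewrite -rowE.
Qed.

(** The rows added to row [i] are at least as heavy as [i], and so are the rows needed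
    to undo the operation. *)
Lemma replace_row_graded_inverse k (w : 'I_k -> nat) i (y : 'rV[F]_k) :
  y 0 i != 0 -> (forall b, y 0 b != 0 -> (w i <= w b)%N) ->
  exists S', graded_inverse w (replace_row i y) S'.
Proof.
move=> yi0 wy.
have gR (x : 'rV_k) : (forall b, x 0 b != 0 -> (w i <= w b)%N) ->
    graded w w (replace_row i x).
  move=> wx a b; rewrite mxE; case: (eqVneq a i) => [->|_]; first exact: wx.
  by case: (eqVneq a b) => [->|_]; rewrite ?eqxx.
(* [x] solves [y 0 i *: x + z = e] for the unit vector [e] of index [i], where
   [z = y - y 0 i *: e]: it expresses [e] through [y] and the other unit vectors. *)
pose e : 'rV[F]_k := delta_mx 0 i.
pose x : 'rV[F]_k := (y 0 i)^-1 *: ((1 + y 0 i) *: e - y).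
have RR : replace_row i y *m replace_row i x = 1%:M.
  apply/row_matrixP => a; rewrite row_replace_row row1.
  case: (eqVneq a i) => [->|ai].
    apply/rowP => b; rewrite !mxE (bigD1 i) //= !mxE eqxx mulrA.
    rewrite divff // mul1r.
    rewrite (eq_bigr (fun j => if j == b then y 0 j else 0)); last first.
      by move=> j /negPf ji; rewrite mxE ji; case: eqP => _; rewrite ?mulr1 ?mulr0.
    rewrite -big_mkcondr /=.
    case: (eqVneq b i) => [->|bi] /=.
      rewrite big1 ?addr0; last by move=> j /andP[/negPf->].
      by rewrite mulr1 addrK.
    rewrite mulr0 sub0r (big_pred1 b) ?addNr // => j /=.
    by case: (eqVneq j b) => [->|_]; rewrite ?bi ?andbF.
  by apply/rowP => b; rewrite !mxE (negPf ai) eq_sym.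
exists (replace_row i x); split; rewrite ?RR //; [exact: gR | | exact: mulmx1C].
apply: gR => b; rewrite !mxE eqxx /=; case: (eqVneq b i) => [->//|bi].
rewrite mulr0 sub0r => h; apply: wy; apply: contraNneq h => ->.
by rewrite oppr0 mulr0.
Qed.

(** One elimination step per row, the rows being taken by decreasing weight: [D] is
    the set of rows already treated, and it is closed under passing to strictly
    heavier rows.  The values of [f] outside [D] come from [f0]. *)
Lemma graded_elimination m k (u : 'I_m -> nat) (w : 'I_k -> nat) (A : 'M[F]_(m, k))
    (f0 : 'I_m -> 'I_k) :
  graded u w A -> (forall x : 'rV_m, x *m A = 0 -> x = 0) ->
  forall d, (d <= m)%N ->
  exists (D : {set 'I_m}) (f : 'I_m -> 'I_k) (P P' : 'M_m) (G G' : 'M_k),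
    [/\ #|D| = d, (forall i j, i \in D -> j \notin D -> (u j <= u i)%N),
        {in D &, injective f} /\ (forall i, i \in D -> row i (P *m A) = row (f i) G),
        graded_inverse u P P' & graded_inverse w G G'].
Proof.
move=> gA indA; elim=> [|d IH] ltdm.
  exists set0, f0, 1%:M, 1%:M, 1%:M, 1%:M.
  split; rewrite ?cards0 //; try by move=> i j; rewrite inE.
  - by split=> [i j|i]; rewrite inE.
  - exact: graded_inverse1.
  exact: graded_inverse1.
have [D [f [P [P' [G [G' [cD upD [injf PAf] giP giG]]]]]]] := IH (ltnW ltdm).
have [i1 i1D] : exists i, i \notin D.
  apply/existsP; apply: contraTT ltdm; rewrite negb_exists => /forallP allD.
  rewrite -leqNgt -cD -[leqLHS]card_ord; apply/subset_leq_card/subsetP => i _.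
  by rewrite -[_ \in _]negbK.
(* The next row is a heaviest one, so that rows of [D] may be added to it. *)
case: (@arg_maxnP _ i1 (fun i => i \notin D) u i1D) => i0 i0D maxi0 {i1 i1D}.
have [gP gP' PP' P'P] := giP; have [gG gG' GG' G'G] := giG.
(* [x] has the coordinates of that row on the rows of [G]; [y] describes the row
   operation that clears those at the pivots, and [z] is what remains. *)
pose x := row i0 (P *m A *m G').
pose y : 'rV[F]_m := delta_mx 0 i0 - \sum_(i in D) x 0 (f i) *: delta_mx 0 i.
have yE j : y 0 j = (j == i0)%:R - (if j \in D then x 0 (f j) else 0).
  rewrite !mxE eqxx summxE; congr (_ - _); rewrite big_mkcond (bigD1 j) //=.
  rewrite big1 ?addr0; last first.
    by move=> i /negPf ij; case: ifP => // _; rewrite !mxE eq_sym ij mulr0.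
  by case: ifP => // _; rewrite !mxE !eqxx mulr1.
have y0 : y 0 i0 = 1 by rewrite yE eqxx (negPf i0D) subr0.
have [T' giT] : exists T', graded_inverse u (replace_row i0 y) T'.
  apply: replace_row_graded_inverse => [|b]; first by rewrite y0 oner_eq0.
  rewrite yE; case: (eqVneq b i0) => [->//|_]; rewrite sub0r oppr_eq0.
  case: ifP => [bD _|]; last by rewrite eqxx.
  exact: upD.
set T := replace_row i0 y in giT.
pose z := y *m (P *m A *m G').
have zE : row i0 (T *m (P *m A)) = z *m G.
  by rewrite row_replace_row eqxx /z -!mulmxA G'G mulmx1.
have PAG i : i \in D -> row i (P *m A *m G') = delta_mx 0 (f i).
  by move=> iD; rewrite row_mul PAf // -row_mul GG' row1.
have zf i : i \in D -> z 0 (f i) = 0.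
  move=> iD; have -> : z = x - \sum_(j in D) x 0 (f j) *: delta_mx 0 (f j).
    rewrite /z mulmxBl -rowE -/x mulmx_suml; congr (_ - _).
    by apply: eq_bigr => j jD; rewrite -scalemxAl -rowE PAG.
  move: (x) => c; rewrite mxE [X in _ + X]mxE summxE (bigD1 i) //= big1.
    by rewrite !mxE !eqxx mulr1 addr0 subrr.
  move=> j /andP[jD ji]; rewrite !mxE eqxx /=.
  case: eqP => [fij|]; last by rewrite mulr0.
  by move: ji; rewrite (injf _ _ jD iD (esym fij)) eqxx.
have wz j : z 0 j != 0 -> (u i0 <= w j)%N.
  have -> : z 0 j = (T *m (P *m A *m G')) i0 j.
    by have /rowP/(_ j) := row_replace_row i0 y (P *m A *m G') i0; rewrite eqxx !mxE.
  by apply: (gradedM _ (gradedM (gradedM gP gA) gG')); case: giT.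
(* The rows of [A] are independent, hence something remains. *)
have [j1 zj1] : exists j, z 0 j != 0.
  apply/existsP; have: z != 0.
    apply: contra_neq (oner_neq0 F) => z0; rewrite -y0.
    suff -> : y = 0 by rewrite mxE.
    have: y *m P = 0.
      apply: indA; rewrite -mulmxA.
      by rewrite -[P *m A]mulmx1 -G'G mulmxA mulmxA -(mulmxA y) -/z z0 mul0mx.
    by move=> /(congr1 (mulmx^~ P')); rewrite -mulmxA PP' mulmx1 mul0mx.
  apply: contraNT; rewrite negb_exists => /forallP z0.
  by apply/eqP/rowP => j; rewrite [RHS]mxE; apply/eqP; rewrite -[_ == _]negbK.
(* The pivot is a lightest column of the support, so that replacing the basis vector
   of that index by [z] is an admissible operation. *)
case: (@arg_minnP _ j1 (fun j => z 0 j != 0) w zj1) => j0 zj0 minj0 {j1 zj1}.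
have [S' giS] := replace_row_graded_inverse zj0 minj0.
have fj0 i : i \in D -> f i != j0.
  by move=> iD; apply: contraNneq zj0 => <-; rewrite zf.
pose f' i := if i == i0 then j0 else f i.
have nD i : i \in D -> (i == i0) = false.
  by move=> iD; apply: contraNF i0D => /eqP<-.
exists (i0 |: D), f', (T *m P), (P' *m T'), (replace_row j0 z *m G), (G' *m S').
split; [by rewrite cardsU1 i0D cD | | split | exact: graded_inverseM
  | exact: graded_inverseM].
- move=> i j /setU1P[->|iD]; rewrite !inE negb_or => /andP[ji jD].
    exact: maxi0.
  exact: upD.
- move=> i j /setU1P[->|iD] /setU1P[->|jD] //; rewrite /f' ?eqxx ?nD //.
  + by move=> e; have := fj0 j jD; rewrite e eqxx.
  + by move=> e; have := fj0 i iD; rewrite e eqxx.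
  exact: injf.
move=> i; rewrite -mulmxA /f' => /setU1P[->|iD].
  by rewrite zE eqxx row_replace_row eqxx.
rewrite nD // [RHS]row_replace_row (negPf (fj0 i iD)).
by rewrite [LHS]row_replace_row nD // PAf.
Qed.

(** Weighted Gaussian elimination: up to the homogeneous change of basis [G] of the
    columns and [P] of the rows, the matrix selects the columns [f i]. *)
Lemma graded_normal_form m k (u : 'I_m -> nat) (w : 'I_k -> nat) (A : 'M[F]_(m, k)) :
  graded u w A -> (forall x : 'rV_m, x *m A = 0 -> x = 0) ->
  exists (f : 'I_m -> 'I_k) (P P' : 'M_m) (G G' : 'M_k),
    [/\ injective f, P *m A = rowsub f G, (forall i, (u i <= w (f i))%N),
        graded_inverse u P P' & graded_inverse w G G'].
Proof.
move=> gA indA.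
have /fin_all_exists[f0 _] : forall i, exists j, A i j != 0.
  move=> i; apply/existsP; apply: contraT; rewrite negb_exists => /forallP A0.
  have e0 : delta_mx 0 i = 0 :> 'rV[F]_m.
    apply: indA; rewrite -rowE; apply/rowP => j; rewrite !mxE.
    by apply/eqP; rewrite -[_ == _]negbK.
  by have /rowP/(_ i) := e0; rewrite !mxE !eqxx => /eqP; rewrite oner_eq0.
have [D [f [P [P' [G [G' [cD _ [injf PAf] giP giG]]]]]]] :=
  graded_elimination f0 gA indA (leqnn m).
have D1 i : i \in D.
  have /setP/(_ i) : D = setT by apply/eqP; rewrite eqEcard subsetT /= cardsT card_ord cD.
  by rewrite inE.
have PA : P *m A = rowsub f G.
  by apply/row_matrixP => i; rewrite PAf //; apply/rowP => j; rewrite !mxE.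
exists f, P, P', G, G'; split=> // [i j|i]; first exact: injf.
have [gP _ _ _] := giP; have [gG _ GG' _] := giG.
have [_ gG' _ _] := giG; apply: (gradedM (gradedM gP gA) gG').
have -> : (P *m A *m G') i (f i) = (G *m G') (f i) (f i).
  by rewrite PA !mxE; apply: eq_bigr => j _; rewrite mxE.
by rewrite GG' mxE eqxx oner_eq0.
Qed.

End GradedMatrices.

(** * Selection matrices *)

Section Selection.
Variable R : comNzRingType.

(** Right multiplication by [selection f] extends a row vector along [f]; by its
    transpose, it restricts a row vector along [f]. *)
Definition selection m k (f : 'I_m -> 'I_k) : 'M[R]_(m, k) := rowsub f 1%:M.

Lemma selection_mulT m l k (f : 'I_m -> 'I_k) (g : 'I_l -> 'I_k) :
  selection f *m (selection g)^T = \matrix_(i, j) (f i == g j)%:R.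
Proof.
by apply/matrixP => i j; rewrite mul_rowsub_mx mul1mx !mxE eq_sym.
Qed.

Lemma selection_tr_mul m k (f : 'I_m -> 'I_k) : injective f ->
  (selection f)^T *m selection f = diag_mx (\row_j (j \in codom f)%:R).
Proof.
move=> finj; apply/matrixP => a b; rewrite !mxE.
have [/codomP[i ->]|af] := boolP (a \in codom f).
  rewrite (bigD1 i) //= !mxE eqxx mul1r big1 ?addr0 // => j ji.
  by rewrite !mxE (inj_eq finj) (negPf ji) mul0r.
rewrite mul0rn big1 // => i _; rewrite !mxE.
case: eqP => [fia|_]; last by rewrite mul0r.
by case/negP: af; rewrite -fia codom_f.
Qed.

Lemma selection_diag m k (f : 'I_m -> 'I_k) (v : 'I_k -> R) :
  selection f *m diag_mx (\row_j v j) = diag_mx (\row_i v (f i)) *m selection f.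
Proof.
apply/matrixP => i j; rewrite mul_mx_diag mul_diag_mx !mxE mulrC.
by case: eqP => [->|]; rewrite ?mulr0.
Qed.

Lemma selection_inj_mulT m k (f : 'I_m -> 'I_k) : injective f ->
  selection f *m (selection f)^T = 1%:M.
Proof.
by move=> finj; rewrite selection_mulT; apply/matrixP => i j; rewrite !mxE (inj_eq finj).
Qed.

Section Complementary.
Variables (m q k : nat) (f : 'I_m -> 'I_k) (g : 'I_q -> 'I_k).
Hypotheses (finj : injective f) (ginj : injective g).
Hypothesis fg : forall j, (j \in codom g) = (j \notin codom f).

Lemma selection_disjoint : selection f *m (selection g)^T = 0.
Proof.
rewrite selection_mulT; apply/matrixP => i j; rewrite !mxE.
by case: eqP => // e; have := fg (f i); rewrite codom_f {1}e codom_f.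
Qed.

Lemma selection_split (c : 'rV_k) :
  c = c *m (selection g)^T *m selection g + c *m (selection f)^T *m selection f.
Proof.
rewrite -!mulmxA !selection_tr_mul // -mulmxDr -linearD /=.
rewrite -[LHS]mulmx1; congr (c *m _); apply/matrixP => i j; rewrite !mxE fg.
by case: (_ \in _); rewrite ?addr0 ?add0r.
Qed.

End Complementary.
End Selection.

(** * Homogeneous matrices *)

Section Scaling.
Variables (F : fieldType) (L : comNzRingType) (iota : {rmorphism F -> L}) (t : L).

(** The homogeneous matrix attached to [A].  With [t] the variable of a ring of power
    series this is the weighted version of [A]; with [t = 1] it is [A] itself, viewed
    in [L]. *)
Definition scale_mx m k (u : 'I_m -> nat) (w : 'I_k -> nat) (A : 'M[F]_(m, k)) :
    'M[L]_(m, k) :=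
  \matrix_(i, j) (iota (A i j) * t ^+ (w j - u i)).

Lemma scale_mxM m k l u w x (A : 'M_(m, k)) (B : 'M_(k, l)) :
  graded u w A -> graded w x B ->
  scale_mx u x (A *m B) = scale_mx u w A *m scale_mx w x B.
Proof.
move=> gA gB; apply/matrixP => i j; rewrite !mxE rmorph_sum mulr_suml.
apply: eq_bigr => h _; rewrite !mxE rmorphM.
have [->|/gA uw] := eqVneq (A i h) 0; first by rewrite !rmorph0 !mul0r.
have [->|/gB wx] := eqVneq (B h j) 0; first by rewrite !rmorph0 mulr0 !mul0r mulr0.
rewrite mulrACA -exprD; congr (_ * t ^+ _).
by rewrite addnC addnBA // subnK.
Qed.

Lemma scale_mx1 k (w : 'I_k -> nat) : scale_mx w w 1%:M = 1%:M.
Proof.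
apply/matrixP => i j; rewrite !mxE; have [->|_] := eqVneq i j.
  by rewrite subnn rmorph1 mulr1.
by rewrite rmorph0 mul0r.
Qed.

Lemma scale_graded_inverse k (w : 'I_k -> nat) G G' :
  graded_inverse w G G' ->
  scale_mx w w G *m scale_mx w w G' = 1%:M /\ scale_mx w w G' *m scale_mx w w G = 1%:M.
Proof. by move=> [gG gG' GG' G'G]; rewrite -!scale_mxM // GG' G'G !scale_mx1. Qed.

(** In the basis given by the rows of the lift of [G], the row space of the lift of
    [A] is spanned by multiples of basis vectors: row [f i] of the lift of [G] is that
    of [P *m A] up to the power of [t] that accounts for the change of degree from
    [u i] to [w (f i)]. *)
Lemma scale_mx_row_space m k (u : 'I_m -> nat) (w : 'I_k -> nat) A f P P' G G' :
  graded u w A -> P *m A = rowsub f G -> (forall i, (u i <= w (f i))%N) ->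
  graded_inverse u P P' -> graded_inverse w G G' ->
  forall c : 'rV_k,
  (exists x, c *m scale_mx w w G = x *m scale_mx u w A) <->
  (exists x, c = x *m diag_mx (\row_i t ^+ (w (f i) - u i)) *m selection L f).
Proof.
move=> gA PA uf giP giG c; set D := diag_mx _.
have [gG _ _ _] := giG; have [gP _ _ _] := giP.
have [PP' P'P] := scale_graded_inverse giP; have [GG' G'G] := scale_graded_inverse giG.
have E : scale_mx u u P *m scale_mx u w A = D *m selection L f *m scale_mx w w G.
  rewrite -scale_mxM // PA -mulmxA /selection mul_rowsub_mx mul1mx mul_diag_mx.
  apply/matrixP => i j; rewrite !mxE mulrCA -exprD.
  have [->|/gG wG] := eqVneq (G (f i) j) 0; first by rewrite rmorph0 !mul0r.
  by congr (_ * t ^+ _); rewrite addnC addnBA // subnK.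
split=> -[x cE].
  exists (x *m scale_mx u u P').
  rewrite -[LHS]mulmx1 -GG' mulmxA cE -!mulmxA; congr (x *m _).
  rewrite -[scale_mx u w A]mul1mx -P'P -!mulmxA; congr (_ *m _).
  by rewrite mulmxA E -!mulmxA GG' mulmx1.
by exists (x *m scale_mx u u P); rewrite cE -[RHS]mulmxA E !mulmxA.
Qed.

End Scaling.

(** * Linear maps and quotients *)

Section LinearMaps.
Variable R : comNzRingType.

Lemma corestrict (U W : lmodType R) (S : submodClosed W) (h : {linear U -> W}) :
  (forall x, h x \in S) -> exists g : {linear U -> submod S}, forall x, val (g x) = h x.
Proof.
move=> hS; pose g x := Submod (hS x).
have glin : linear g by move=> a x y; apply: val_inj; rewrite /= linearP.
pose gL := GRing.isLinear.Build R U (submod S) _ g glin.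
by exists (HB.pack_for {linear U -> submod S} g gL).
Qed.

(** The universal property of a quotient, for a quotient given as a surjection. *)
Lemma factor_through (U W W' : lmodType R) (p : {linear U -> W}) (h : {linear U -> W'}) :
  (forall y, exists x, p x = y) -> (forall x, p x = 0 -> h x = 0) ->
  exists g : {linear W -> W'}, forall x, g (p x) = h x.
Proof.
move=> psurj kerp; pose s y := projT1 (cid (psurj y)).
have sK y : p (s y) = y := projT2 (cid (psurj y)).
pose g y := h (s y).
have gp x : g (p x) = h x.
  by apply/eqP; rewrite -subr_eq0 -linearB kerp // linearB /= sK subrr.
have glin : linear g.
  by move=> a x y; rewrite -[x]sK -[y]sK -linearP !gp linearP.
pose gL := GRing.isLinear.Build R W W' _ g glin.
by exists (HB.pack_for {linear W -> W'} g gL).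
Qed.

Lemma lin_iso_of_presentations (U W W' : lmodType R)
    (p : {linear U -> W}) (p' : {linear U -> W'}) :
  (forall y, exists x, p x = y) -> (forall y, exists x, p' x = y) ->
  (forall x, p x = 0 <-> p' x = 0) -> lin_iso W W'.
Proof.
move=> ps ps' ker.
have [g gE] := factor_through ps (fun x => (ker x).1).
have [g' g'E] := factor_through ps' (fun x => (ker x).2).
exists g; exists g' => y.
  by have [x <-] := ps y; rewrite gE g'E.
by have [x <-] := ps' y; rewrite g'E gE.
Qed.

Lemma dirsum_cyclic_presentation m (v : 'I_m -> R) :
  exists h : {linear 'rV[R]_m -> dirsum (fun s => cyclic_mod (v s))},
    (forall y, exists x, h x = y) /\
    (forall x, h x = 0 <-> exists z, x = z *m diag_mx (\row_s v s)).
Proof.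
pose U s : lmodType R := cyclic_mod (v s).
pose p s : {linear R^o -> U s} := proj (multiples (v s)).
pose h (x : 'rV[R]_m) : dirsum U := [ffun s => p s (x 0 s) : U s].
have hlin : linear h.
  by move=> a x y; apply/ffunP => s; rewrite !ffunE -linearP !mxE.
pose hL := GRing.isLinear.Build R 'rV[R]_m (dirsum U) _ h hlin.
exists (HB.pack_for {linear 'rV[R]_m -> dirsum U} h hL); split=> [y|x] /=.
  have /choice[x xE] : forall s, exists a, p s a = y s by move=> s; eexists; exact: projK.
  by exists (\row_s x s); apply/ffunP => s; rewrite ffunE mxE xE.
have p0 s (a : R) : p s a = 0 <-> exists c, a = c * v s.
  rewrite -(linear0 (p s)); split=> [/eqP|[c ac]].
    by rewrite proj_eq subr0 => /asboolP.
  by apply/eqP; rewrite proj_eq subr0; apply/asboolP; exists c.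
split=> [/ffunP hx|[z ->]].
  have /choice[z zE] : forall s, exists c, x 0 s = c * v s.
    by move=> s; apply/p0; have := hx s; rewrite !ffunE.
  by exists (\row_s z s); rewrite mul_mx_diag; apply/rowP => s; rewrite !mxE zE.
apply/ffunP => s; rewrite !ffunE; apply/p0; exists (z 0 s).
by rewrite mul_mx_diag !mxE.
Qed.

End LinearMaps.

(** * Rank over a domain *)

Section Rank.
Variable R : idomainType.

(** Fraction-free elimination: clearing the first column against a nonzero entry [p]
    of it requires multiplying the other rows by [p], which is harmless in a
    domain. *)
Lemma left_kernel_of_tall q s (C : 'M[R]_(s, q)) :
  (q < s)%N -> exists2 x : 'rV_s, x != 0 & x *m C = 0.
Proof.
elim: q s C => [|q IH] [//|s] C lt.
  exists (const_mx 1); last by apply/rowP => -[].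
  by apply/eqP => /rowP/(_ ord0)/eqP; rewrite !mxE oner_eq0.
have [/existsP[i0 p0]|] := boolP [exists i, C i ord0 != 0]; last first.
  rewrite negb_exists => /forallP C0.
  have [x x0 xC] := IH s.+1 (col' ord0 C) (ltnW lt); exists x => //.
  apply/rowP => j; case: (unliftP ord0 j) => [j'|] ->.
    have /rowP/(_ j') := xC; rewrite !mxE; apply: etrans.
    by apply: eq_bigr => i _; rewrite !mxE.
  rewrite !mxE big1 // => i _.
  by have := C0 i; rewrite negbK => /eqP->; rewrite mulr0.
set p := C i0 ord0 in p0.
pose C' := \matrix_(i, j)
  (p * C (lift i0 i) (lift ord0 j) - C (lift i0 i) ord0 * C i0 (lift ord0 j)).
have [y y0 yC] := IH s C' lt.
pose x : 'rV_s.+1 := \row_i if unlift i0 i is Some j then p * y 0 j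
                            else - \sum_j y 0 j * C (lift i0 j) ord0.
have xC j : (x *m C) 0 j =
    \sum_i y 0 i * (p * C (lift i0 i) j - C (lift i0 i) ord0 * C i0 j).
  rewrite mxE (bigD1_ord i0) //= !mxE unlift_none mulNr mulr_suml -sumrN -big_split /=.
  by apply: eq_bigr => i _; rewrite !mxE liftK mulrBr !mulrA addrC (mulrC p).
exists x.
  apply: contra_neq y0 => /rowP x0; apply/rowP => i.
  have := x0 (lift i0 i); rewrite !mxE liftK => /eqP.
  by rewrite mulf_eq0 (negPf p0) => /eqP.
apply/rowP => j; rewrite xC [RHS]mxE; case: (unliftP ord0 j) => [j'|] ->.
  have /rowP/(_ j') := yC; rewrite !mxE; apply: etrans.
  by apply: eq_bigr => i _; rewrite !mxE.
by rewrite big1 // => i _; rewrite -/p mulrC (mulrC p) subrr mul0r.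
Qed.

End Rank.

(** * Modules with a diagonal presentation *)

Lemma linear_row (R : comNzRingType) q (H : lmodType R) (h : {linear 'rV[R]_q -> H})
    (c : 'I_q -> R) :
  h (\row_i c i) = \sum_(i in [set: 'I_q]) c i *: h (delta_mx 0 i).
Proof.
rewrite (row_sum_delta (\row_i c i)) linear_sum [RHS]big_mkcond /=.
by apply: eq_bigr => i _; rewrite inE linearZ mxE.
Qed.

Section Presentations.
Variables (R : idomainType) (m q k : nat) (f : 'I_m -> 'I_k) (g : 'I_q -> 'I_k).
Hypotheses (finj : injective f) (ginj : injective g).
Hypothesis fg : forall j, (j \in codom g) = (j \notin codom f).

Local Notation Sf := (selection R f).
Local Notation Sg := (selection R g).

(** A presentation of [H] as the sum of the cyclic modules [R / (d i)], generated by
    the basis vectors of index [f i], and of a free module, with basis the vectors of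
    index [g s]. *)
Definition presents (H : lmodType R) (Phi : {linear 'rV[R]_k -> H}) (d : 'I_m -> R) :=
  (forall y, exists c, Phi c = y) /\
  (forall c, Phi c = 0 <-> exists x, c = x *m diag_mx (\row_i d i) *m Sf).

Section Presented.
Variables (H : lmodType R) (Phi : {linear 'rV[R]_k -> H}) (d : 'I_m -> R).
Hypotheses (d_neq0 : forall i, d i != 0) (PhiP : presents Phi d).

Definition free_part : {linear 'rV[R]_q -> H} := Phi \o mulmxr Sg.
Definition tors_part : {linear 'rV[R]_m -> H} := Phi \o mulmxr Sf.

Lemma free_partE y : free_part y = Phi (y *m Sg). Proof. by []. Qed.
Lemma tors_partE y : tors_part y = Phi (y *m Sf). Proof. by []. Qed.

Lemma free_part_eq0 y : free_part y = 0 -> y = 0.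
Proof.
have [_ kerPhi] := PhiP; rewrite free_partE => /kerPhi[x yE].
rewrite -[y]mulmx1 -(selection_inj_mulT R ginj) mulmxA yE -mulmxA.
by rewrite (selection_disjoint R fg) mulmx0.
Qed.

Lemma tors_part_eq0 y : tors_part y = 0 <-> exists x, y = x *m diag_mx (\row_i d i).
Proof.
have [_ kerPhi] := PhiP; rewrite tors_partE kerPhi; split=> -[x yE]; exists x.
  rewrite -[y]mulmx1 -(selection_inj_mulT R finj) mulmxA yE -mulmxA.
  by rewrite selection_inj_mulT ?mulmx1.
by rewrite yE.
Qed.

Lemma presented_split h : exists a b, h = free_part a + tors_part b.
Proof.
have [/(_ h)[c <-] _] := PhiP; exists (c *m Sg^T), (c *m Sf^T).
by rewrite free_partE tors_partE -linearD -selection_split.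
Qed.

(** A common annihilator of the torsion. *)
Let delta := \prod_i d i.

Let delta_neq0 : delta != 0. Proof. by apply/prodf_neq0 => i _. Qed.

Lemma scale_tors_part y : delta *: tors_part y = 0.
Proof.
rewrite -linearZ; apply/tors_part_eq0.
exists (\row_i (\prod_(j | j != i) d j * y 0 i)); rewrite mul_mx_diag.
by apply/rowP => i; rewrite !mxE /delta (bigD1 i) //= [RHS]mulrC mulrA.
Qed.

Lemma tors_part_torsion y : tors_part y \in torsion H.
Proof. by apply/asboolP; exists delta; rewrite ?scale_tors_part. Qed.

Lemma torsion_free_part a : free_part a \in torsion H -> a = 0.
Proof.
move=> /asboolP[e e0]; rewrite -linearZ /= => /free_part_eq0/rowP ea0.
apply/rowP => i; have /eqP := ea0 i; rewrite !mxE mulf_eq0 (negPf e0).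
by move/eqP.
Qed.

Lemma torsion_tors_part h : h \in torsion H -> exists y, tors_part y = h.
Proof.
have [a [b ->]] := presented_split h => tab; exists b.
have ta : free_part a \in torsion H.
  rewrite -[free_part a](addrK (tors_part b)); apply: rpredD => //.
  by rewrite -scaleN1r; apply: rpredZ; apply: tors_part_torsion.
by rewrite (torsion_free_part ta) linear0 add0r.
Qed.

Definition free_im : {pred H} := fun y => `[< exists x, free_part x = y >].

Fact free_im_closed : subsemimod_closed free_im.
Proof.
split; first split=> [|x y /asboolP[a <-] /asboolP[b <-]].
- by apply/asboolP; exists 0; rewrite linear0.
- by apply/asboolP; exists (a + b); rewrite linearD.
by move=> e x /asboolP[a <-]; apply/asboolP; exists (e *: a); rewrite linearZ.
Qed.

HB.instance Definition _ := GRing.isSubmodClosed.Build R H free_im free_im_closed.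

Definition free_sub : submodClosed H := free_im.

Lemma free_sub_coord :
  exists p : {linear 'rV[R]_q -> submod free_sub},
    [/\ forall x, val (p x) = free_part x, forall x, p x = 0 -> x = 0
      & forall y, exists x, p x = y].
Proof.
have [x|p pE] := @corestrict _ _ _ free_sub free_part.
  by apply/asboolP; exists x.
exists p; split=> // [x /(congr1 val)|[y yS]]; first by rewrite pE => /free_part_eq0.
have /asboolP[x xE] := yS; exists x; apply: val_inj.
by rewrite pE.
Qed.

Lemma direct_sum_torsion : internal_direct_sum free_sub (torsion H).
Proof.
split=> [x|x /asboolP[a <-]]; last by move/torsion_free_part->; rewrite linear0.
have [a [b ->]] := presented_split x.
exists (free_part a); first by apply/asboolP; exists a.
by exists (tors_part b) => //; apply: tors_part_torsion.
Qed.

Lemma free_sub_is_free : is_free (submod free_sub).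
Proof.
have [p [_ p0 psurj]] := free_sub_coord.
exists q, (fun s => p (delta_mx 0 s)).
split=> // [c|x _].
  by rewrite -linear_row => /p0/rowP c0 i _; have := c0 i; rewrite !mxE.
have [y <-] := psurj x; exists (y 0); rewrite -linear_row; congr (p _).
by apply/rowP => i; rewrite mxE.
Qed.

Lemma torsion_iso : lin_iso (submod (torsion H)) (dirsum (fun s => cyclic_mod (d s))).
Proof.
have [h [hsurj h0]] := dirsum_cyclic_presentation d.
have [p pE] := @corestrict _ _ _ (torsion H) tors_part tors_part_torsion.
apply: (@lin_iso_of_presentations _ _ _ _ p h _ hsurj) => [[y yT]|x].
  by have [x xE] := torsion_tors_part yT; exists x; apply: val_inj; rewrite pE.
rewrite h0 -tors_part_eq0 -pE; split=> [->|e]; first by [].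
exact: val_inj.
Qed.

(** Multiplication by [delta] sends a family of vectors into the free part, without
    losing independence; more than [q] vectors of a module of rank [q] are
    dependent. *)
Lemma presented_rank : has_rank H q.
Proof.
split.
  exists (fun s => free_part (delta_mx 0 s)) => c.
  rewrite -(linear_row free_part) => /free_part_eq0/rowP c0 i _.
  by have := c0 i; rewrite !mxE.
move=> s b bind; rewrite leqNgt; apply/negP => qs.
have /choice[a aE] : forall i, exists a, delta *: b i = free_part a.
  move=> i; have [a [c ->]] := presented_split (b i); exists (delta *: a).
  by rewrite scalerDr scale_tors_part addr0 linearZ.
have [x x0 xa] := left_kernel_of_tall (\matrix_(i < s) a i) qs.
case/negP: x0; apply/eqP/rowP => i; rewrite [RHS]mxE.
have: x 0 i * delta = 0.
  apply: (bind (fun i => x 0 i * delta)); last by rewrite inE.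
  rewrite -[RHS](linear0 free_part) -xa mulmx_sum_row linear_sum [LHS]big_mkcond.
  by apply: eq_bigr => j _; rewrite inE -scalerA aE linearZ rowK.
by move/eqP; rewrite mulf_eq0 (negPf delta_neq0) orbF => /eqP.
Qed.

End Presented.

(** The relations of [H] kill the basis vectors of index [f i] altogether, so both [H]
    and the free part of [HV] are free on the [g s], and [th] becomes the diagonal map
    with entries [v (g s)].  Its well-definedness forces the images of the vectors of
    index [f i] to vanish in [HV]. *)
Lemma presented_exact (H HV : lmodType R)
    (Psi : {linear 'rV[R]_k -> H}) (Phi : {linear 'rV[R]_k -> HV})
    (d : 'I_m -> R) (v : 'I_k -> R) (th : {linear H -> HV}) :
  (forall j, v j != 0) ->
  presents Psi (fun=> 1) -> presents Phi d ->
  (forall c, th (Psi c) = Phi (c *m diag_mx (\row_j v j))) ->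
  exists (i : {linear H -> submod (free_sub Phi)})
         (j : {linear submod (free_sub Phi) -> dirsum (fun s => cyclic_mod (v (g s)))}),
    (forall x, val (i x) = th x) /\ short_exact i j.
Proof.
move=> v0 PsiP PhiP thE.
have thfree y : th (free_part Psi y) = free_part Phi (y *m diag_mx (\row_s v (g s))).
  by rewrite !free_partE thE -!mulmxA selection_diag.
have Psisurj x : exists y, free_part Psi y = x.
  have [a [b ->]] := presented_split PsiP x; exists a.
  suff -> : tors_part Psi b = 0 by rewrite addr0.
  apply/(tors_part_eq0 PsiP); exists b; rewrite mul_mx_diag.
  by apply/rowP => i; rewrite !mxE mulr1.
have [p [pE p0 psurj]] := free_sub_coord PhiP.
have [x|i iE] := @corestrict _ _ _ (free_sub Phi) th.
  have [y <-] := Psisurj x; rewrite thfree; apply/asboolP; by eexists.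
have [h [hsurj h0]] := dirsum_cyclic_presentation (fun s => v (g s)).
have [|j jE] := @factor_through _ _ _ _ p h psurj.
  by move=> x /p0->; rewrite linear0.
have ip y : i (free_part Psi y) = p (y *m diag_mx (\row_s v (g s))).
  by apply: val_inj; rewrite iE pE thfree.
exists i, j; split=> //; split.
- move=> x y /eqP; rewrite -subr_eq0 -linearB => /eqP ixy; apply/eqP; rewrite -subr_eq0.
  have [z zE] := Psisurj (x - y); move: ixy; rewrite -zE ip => /p0.
  rewrite mul_mx_diag => /rowP zv; suff -> : z = 0 by rewrite linear0.
  apply/rowP => s; have /eqP := zv s; rewrite !mxE mulf_eq0 (negPf (v0 _)) orbF.
  by move/eqP.
- move=> y; have [z <-] := psurj y; rewrite jE h0; split=> [[x ->]|[x]].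
    by exists (free_part Psi x); rewrite ip.
  have [w <-] := Psisurj x; rewrite ip => /eqP; rewrite -subr_eq0 -linearB => /eqP/p0/eqP.
  by rewrite subr_eq0 => /eqP <-; exists w.
move=> z; have [x <-] := hsurj z; exists (p x); exact: jE.
Qed.

End Presentations.

(** * Incidence numbers and d d = 0 *)

Section DoubleBoundary.

Lemma index_filter_index (T : eqType) (l : seq T) i x :
  uniq l -> x \in l -> index x l != i ->
  index x [seq y <- l | index y l != i] = unbump i (index x l).
Proof.
elim: l i => //= a l IH i /andP[al ul]; rewrite inE.
have notin y : y \in l -> (a == y) = false by move=> yl; apply: contraNF al => /eqP->.
case: i => [|i].
  rewrite eqxx /=.
  have -> : [seq y <- l | (if a == y then 0 else (index y l).+1)%N != 0%N] = l.
    by apply/all_filterP/allP => y yl; rewrite notin.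
  by rewrite eq_sym; case: eqP => //= _ _; rewrite /unbump subn1.
rewrite /= eqxx /= eq_sym; case: eqP => [//|_] /= xl; rewrite eqSS => ix.
have -> : [seq y <- l | (if a == y then 0 else (index y l).+1)%N != i.+1] =
    [seq y <- l | index y l != i].
  by apply: eq_in_filter => y yl; rewrite notin // eqSS.
rewrite IH // /unbump ltnS.
lia.
Qed.

(** The combinatorial core of [d d = 0]: the pairs [(i, j)] with [i <= j] and the pairs
    [(j.+1, i)] have opposite signs. *)
Lemma sum_signed_cancel (A : pzRingType) N (G : nat -> nat -> A) :
  (forall i j, (i <= j)%N -> G i j = G j.+1 i) ->
  \sum_(i < N.+1) \sum_(j < N) (-1) ^+ (i + j) * G i j = 0.
Proof.
move=> GE; pose H i j := (-1) ^+ (i + j) * G i j.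
have splitH i : \sum_(j < N) H i j =
    \sum_(j < N | (i <= j)%N) H i j + \sum_(j < N | (j < i)%N) H i j.
  rewrite (bigID (fun j : 'I_N => (i <= j)%N)) /=; congr (_ + _).
  by apply: eq_bigl => j; rewrite -ltnNge.
rewrite (eq_bigr _ (fun (i : 'I_N.+1) _ => splitH i)) big_split /=.
rewrite big_ord_recr /= [X in _ + X + _]big1 ?addr0; last first.
  by move=> j; rewrite leqNgt ltn_ord.
rewrite [X in _ + X]big_ord_recl /= [X in _ + (X + _)]big1 ?add0r //.
rewrite [X in _ + X](exchange_big_dep xpredT) //= -big_split big1 //= => i _.
apply/eqP; rewrite addr_eq0 -sumrN; apply/eqP; apply: eq_big => j; first by rewrite ltnS.
by move=> ij; rewrite /H /bump /= add1n addSn exprS mulN1r mulNr opprK GE // addnC.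
Qed.

Context {disp : Order.disp_t} {V : finOrderType disp}.
Implicit Type s : {set V}.

Lemma enum_del_vertex s i :
  Order.enum (del_vertex s i) = [seq x <- Order.enum s | index x (Order.enum s) != i].
Proof.
rewrite filter_sort;
  [|exact: Order.TotalTheory.le_total|exact: Order.POrderTheory.le_trans].
congr (sort _ _); rewrite /enum_mem -filter_predI; apply: eq_filter => x /=.
by rewrite !inE andbC.
Qed.

Lemma del_vertexC s i j : (i <= j)%N ->
  del_vertex (del_vertex s i) j = del_vertex (del_vertex s j.+1) i.
Proof.
move=> ij; apply/setP => x; rewrite !inE -!andbA; case: (boolP (x \in s)) => //= xs.
have xe : x \in Order.enum s by rewrite Order.mem_enum.
have us : uniq (Order.enum s) by exact: Order.enum_uniq.
rewrite !enum_del_vertex; set l := Order.enum s in xe us *.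
have [xi|xi] := eqVneq (index x l) i; have [xj|xj] := eqVneq (index x l) j.+1 => //=.
- by rewrite index_filter_index // xi /unbump ltnNge (leq_trans ij) // subn0 eqxx.
- by rewrite index_filter_index // xj /unbump ltnS ij subn1 eqxx.
rewrite !index_filter_index // /unbump.
lia.
Qed.

End DoubleBoundary.

Section Incidence.
Context {disp : Order.disp_t} {V : finOrderType disp} {X : wcomplex V}.

(** The coefficient of [t] in the ordinary boundary of [s]. *)
Definition incidence (A : comNzRingType) n (s : simplex X n.+1) (t : simplex X n) : A :=
  \sum_(i < n.+2) (-1) ^+ i * (val t == del_vertex (val s) i)%:R.

Lemma incidence_sub (A : comNzRingType) n (s : simplex X n.+1) (t : simplex X n) :
  incidence A s t != 0 -> val t \subset val s.
Proof.
apply: contraR => ts; rewrite /incidence big1 // => i _.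
case: eqP => [tE|_]; last by rewrite mulr0.
by case/negP: ts; rewrite tE; apply/subsetP => x; rewrite inE => /andP[].
Qed.

Lemma rmorph_incidence (A B : comNzRingType) (phi : {rmorphism A -> B}) n
    (s : simplex X n.+1) (t : simplex X n) :
  phi (incidence A s t) = incidence B s t.
Proof.
by rewrite rmorph_sum; apply: eq_bigr => i _; rewrite rmorphM rmorph_sign rmorph_nat.
Qed.

Lemma boundaryE (A : comNzRingType) e n (c : chain X A n.+1) t :
  boundary X e n.+1 c t = \sum_s c s * (e (val t) (val s) * incidence A s t).
Proof.
rewrite [LHS]sum_ffunE; apply: eq_bigr => s _; rewrite [LHS]chain_scaleE; congr (c s * _).
rewrite sum_ffunE mulr_sumr; apply: eq_bigr => i _.
rewrite [LHS]chain_scaleE genE -val_eqE /=.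
case: eqP => [->|_]; last by rewrite !mulr0.
by rewrite !mulr1 mulrC.
Qed.

Lemma boundary_gen (A : comNzRingType) e n (s : simplex X n.+1) t :
  boundary X e n.+1 (gen A s) t = e (val t) (val s) * incidence A s t.
Proof.
rewrite boundaryE (bigD1 s) //= genE eqxx mul1r big1 ?addr0 // => r rs.
by rewrite genE (negPf rs) mul0r.
Qed.

Lemma incidence_incidence (A : comNzRingType) n (s : simplex X n.+2) (r : simplex X n) :
  \sum_t incidence A s t * incidence A t r = 0.
Proof.
pose G i j : A := (val r == del_vertex (del_vertex (val s) i) j)%:R.
rewrite -[RHS](@sum_signed_cancel A n.+2 G); last first.
  by move=> i j ij; rewrite /G del_vertexC.
rewrite (eq_bigr (fun t =>
  \sum_(i < n.+3) (-1) ^+ i * (t == face s i)%:R * incidence A t r)); last first.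
  by move=> t _; rewrite mulr_suml.
rewrite exchange_big /=; apply: eq_bigr => i _.
rewrite (bigD1 (face s i)) //= big1 ?addr0; last first.
  by move=> t /negPf ts; rewrite ts mulr0 mul0r.
rewrite eqxx mulr1 mulr_sumr; apply: eq_bigr => j _.
by rewrite mulrA exprD.
Qed.

Lemma sboundary_sboundary (A : comNzRingType) n (c : chain X A n.+1) :
  sboundary X A n (sboundary X A n.+1 c) = 0.
Proof.
case: n c => [//|n] c; apply/ffunP => r; rewrite [RHS]ffunE /sboundary boundaryE.
rewrite (eq_bigr (fun t => \sum_s c s * (incidence A s t * incidence A t r))); last first.
  by move=> t _; rewrite boundaryE mulr_suml; apply: eq_bigr => s _; rewrite !mul1r mulrA.
rewrite exchange_big big1 // => s _.
by rewrite -mulr_sumr incidence_incidence mulr0.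
Qed.

End Incidence.

(** * Power series *)

Section PowerSeries.
Variable A : comNzRingType.
Implicit Type f : {fps A}.

Lemma coefs_fpsC_mul a f n : coefs (fpsC a * f) n = a * coefs f n.
Proof.
rewrite coefsM big_ord_recl coefs_fpsC subn0 big1 ?addr0 // => i _.
by rewrite coefs_fpsC mul0r.
Qed.

Lemma coefs_var_exp k n : coefs (fps_var A ^+ k) n = (n == k)%:R.
Proof.
elim: k n => [|k IH] n; first by rewrite expr0 coefs1.
rewrite exprS coefsM; case: n => [|n].
  by rewrite big_ord1 coefs_var mul0r.
rewrite !big_ord_recl !coefs_var /= mul0r add0r mul1r subSS subn0 IH big1 ?addr0 //.
by move=> i _; rewrite coefs_var mul0r.
Qed.

Fact fpsC_is_zmod_morphism : zmod_morphism (@fpsC A).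
Proof.
move=> a b; apply/fpsP => n; rewrite coefsD coefsN !coefs_fpsC.
by case: eqP; rewrite ?subr0.
Qed.
Fact fpsC_is_monoid_morphism : monoid_morphism (@fpsC A).
Proof.
split=> [//|a b]; apply/fpsP => n.
by rewrite coefs_fpsC_mul !coefs_fpsC; case: eqP; rewrite ?mulr0.
Qed.

HB.instance Definition _ :=
  GRing.isZmodMorphism.Build A {fps A} (@fpsC A) fpsC_is_zmod_morphism.
HB.instance Definition _ :=
  GRing.isMonoidMorphism.Build A {fps A} (@fpsC A) fpsC_is_monoid_morphism.

Lemma fpsC_inj : injective (@fpsC A).
Proof. by move=> a b /(congr1 (fun f => coefs f 0)); rewrite !coefs_fpsC. Qed.

Lemma fps_var_exp_neq0 k : fps_var A ^+ k != 0.
Proof.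
apply/eqP => /(congr1 (fun f => coefs f k))/eqP.
by rewrite coefs_var_exp coefs0 eqxx oner_eq0.
Qed.

End PowerSeries.

(** * Homogeneous chains *)

Section Lift.
Context {disp : Order.disp_t} {V : finOrderType disp} {X : wcomplex V}.
Variable F : fieldType.
Local Notation w s := (weight X (val s)).

(** The chains of degree [d] over [F]: those whose homogeneous lift has no negative
    exponent. *)
Definition heavy n d (b : chain X F n) := forall s, b s != 0 -> (d <= w s)%N.

Lemma incidence_weight (A : comNzRingType) n (s : simplex X n.+1) (t : simplex X n) :
  incidence A s t != 0 -> (w s <= w t)%N.
Proof.
move=> /incidence_sub; apply: weight_anti; first by case/andP: (valP t).
by case/andP: (valP s).
Qed.

(** A face weighs at least as much as the simplex. *)
Lemma heavy_boundary n d (b : chain X F n) : heavy d b -> heavy d (sboundary X F n b).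
Proof.
case: n b => [b _ s|n b hb s]; first by rewrite [X in X != 0]ffunE eqxx.
rewrite boundaryE => /sum_neq0[r]; rewrite mul1r mulf_eq0 negb_or => /andP[/hb dr].
by move/incidence_weight; apply: leq_trans.
Qed.

Lemma heavy_gen n (s : simplex X n) : heavy (w s) (gen F s).
Proof. by move=> t; rewrite genE; case: (eqVneq t s) => [->|_]; rewrite ?eqxx. Qed.

Lemma chain_gen (A : comNzRingType) n (c : chain X A n) : c = \sum_s c s *: gen A s.
Proof.
apply/ffunP => t; rewrite sum_ffunE (bigD1 t) //= [X in X + _]chain_scaleE genE eqxx mulr1.
by rewrite big1 ?addr0 // => s /negPf st; rewrite [LHS]chain_scaleE genE eq_sym st mulr0.
Qed.

Variables (L : comNzRingType) (iota : {rmorphism F -> L}) (t : L).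

(** The homogeneous chain of degree [d] with coefficients those of [b]. *)
Definition lift_chain n d (b : chain X F n) : chain X L n :=
  [ffun s => iota (b s) * t ^+ (w s - d)].

Lemma lift_chainE n d (b : chain X F n) s :
  lift_chain d b s = iota (b s) * t ^+ (w s - d).
Proof. exact: ffunE. Qed.

Lemma lift_chain0 n d : lift_chain d (0 : chain X F n) = 0.
Proof. by apply/ffunP => s; rewrite lift_chainE !ffunE rmorph0 mul0r. Qed.

Lemma lift_chain_shift n d d' (b : chain X F n) : heavy d b -> (d' <= d)%N ->
  lift_chain d' b = t ^+ (d - d') *: lift_chain d b.
Proof.
move=> hb dd; apply/ffunP => s; rewrite [RHS]chain_scaleE !lift_chainE.
have [->|/hb ds] := eqVneq (b s) 0; first by rewrite rmorph0 !mul0r mulr0.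
by rewrite mulrCA -exprD; congr (_ * t ^+ _); lia.
Qed.

Lemma lift_chain_sum n d (I : finType) (x : I -> F) (b : I -> chain X F n) :
  lift_chain d (\sum_i x i *: b i) = \sum_i iota (x i) *: lift_chain d (b i).
Proof.
apply/ffunP => s; rewrite lift_chainE !sum_ffunE rmorph_sum mulr_suml.
apply: eq_bigr => i _; rewrite [RHS]chain_scaleE [in LHS]ffunE lift_chainE.
by rewrite rmorphM mulrA.
Qed.

Lemma lift_gen n (s : simplex X n) : lift_chain (w s) (gen F s) = gen L s.
Proof.
apply/ffunP => r; rewrite lift_chainE !genE rmorph_nat.
by case: eqP => [->|_]; rewrite ?mul0r // subnn mulr1.
Qed.

(** A single boundary map covers three cases: for [L] the power series ring and [t] its
    variable it is the weighted one; for [t = 1] and [L] the power series ring or [F]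
    it is the ordinary one. *)
Variable e : {set V} -> {set V} -> L.
Hypothesis eE : forall a b, e a b = t ^+ (weight X a - weight X b).

(** The boundary maps are homogeneous: along a face [s] of [r] the exponents [w r - d]
    and [w s - w r] add up to [w s - d]. *)
Lemma boundary_lift n d (b : chain X F n) : heavy d b ->
  boundary X e n (lift_chain d b) = lift_chain d (sboundary X F n b).
Proof.
case: n b => [b _|n b hb].
  by rewrite [sboundary X F 0 b]/(0 : chain X F 0) lift_chain0.
apply/ffunP => s; rewrite lift_chainE /sboundary !boundaryE rmorph_sum mulr_suml.
apply: eq_bigr => r _; rewrite lift_chainE eE mul1r rmorphM rmorph_incidence.
have [->|/hb dr] := eqVneq (b r) 0; first by rewrite rmorph0 !mul0r.
have [->|/incidence_weight rs] := eqVneq (incidence L r s) 0.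
  by rewrite !mulr0 mul0r.
rewrite -!mulrA; congr (_ * _); rewrite mulrA mulrC -exprD; congr (_ * t ^+ _).
by rewrite addnC addnBA // subnK.
Qed.

Lemma boundary_gen_lift n (s : simplex X n.+1) :
  boundary X e n.+1 (gen L s) = lift_chain (w s) (sboundary X F n.+1 (gen F s)).
Proof. by rewrite -lift_gen boundary_lift //; apply: heavy_gen. Qed.

Lemma boundary_boundary_gen n (s : simplex X n.+1) :
  boundary X e n (boundary X e n.+1 (gen L s)) = 0.
Proof.
rewrite boundary_gen_lift boundary_lift.
  by rewrite sboundary_sboundary lift_chain0.
exact: (@heavy_boundary n.+1 _ _ (@heavy_gen _ s)).
Qed.

(** * Homology in coordinates *)

Section HomologyPresentation.
Variables (n m k : nat) (kap : 'I_k -> simplex X n) (mu : 'I_m -> simplex X n.+1).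
Variable b : 'I_k -> chain X F n.
Hypothesis b_kap : forall i j, b i (kap j) = (j == i)%:R.
Hypothesis b_heavy : forall i, heavy (w (kap i)) (b i).
Hypothesis b_cycle : forall i, sboundary X F n (b i) = 0.
Hypothesis mu_span : forall s : simplex X n.+1, exists x : 'I_m -> F,
  (forall i, x i != 0 -> (w s <= w (mu i))%N) /\
  sboundary X F n.+1 (gen F s) = \sum_i x i *: sboundary X F n.+1 (gen F (mu i)).
Hypothesis kap_sep : forall z, boundary X e n z = 0 -> (forall j, z (kap j) = 0) -> z = 0.

Definition incidence_mx : 'M[F]_(m, k) := \matrix_(i, j) incidence F (mu i) (kap j).

Lemma incidence_mx_graded :
  graded (fun i => w (mu i)) (fun j => w (kap j)) incidence_mx.
Proof. by move=> i j; rewrite mxE => /incidence_weight. Qed.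

Local Notation A := (scale_mx iota t (fun i => w (mu i)) (fun j => w (kap j)) incidence_mx).

Definition cycle_of (c : 'rV[L]_k) : chain X L n :=
  \sum_j c 0 j *: lift_chain (w (kap j)) (b j).

Lemma cycle_of_is_linear : linear cycle_of.
Proof.
move=> a x y; rewrite /cycle_of scaler_sumr -big_split; apply: eq_bigr => j _.
by rewrite !mxE scalerDl scalerA.
Qed.
HB.instance Definition _ :=
  GRing.isLinear.Build L 'rV[L]_k (chain X L n) _ cycle_of cycle_of_is_linear.

Lemma cycle_of_ker c : cycle_of c \in lin_ker (boundary X e n).
Proof.
apply/eqP; rewrite linear_sum big1 // => j _.
by rewrite linearZ_LR (boundary_lift (@b_heavy j)) b_cycle lift_chain0 scaler0.
Qed.

Lemma cycle_of_kap c j : cycle_of c (kap j) = c 0 j.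
Proof.
rewrite sum_ffunE (bigD1 j) //= [X in X + _]chain_scaleE lift_chainE b_kap eqxx.
rewrite subnn rmorph1 !mulr1.
rewrite big1 ?addr0 // => i /negPf ij.
by rewrite [LHS]chain_scaleE lift_chainE b_kap eq_sym ij rmorph0 mul0r mulr0.
Qed.

(** The lift of [b j] has coefficient 1 on [kap j] and 0 on the other [kap i], so that
    the difference of both sides is a cycle that vanishes on all [kap i]. *)
Lemma cycle_ofK z : boundary X e n z = 0 -> z = cycle_of (\row_j z (kap j)).
Proof.
move=> z0; apply/eqP; rewrite -subr_eq0; apply/eqP/kap_sep => [|j].
  by rewrite linearB z0 (eqP (cycle_of_ker _)) subrr.
by rewrite [LHS]ffunE [X in _ + X]ffunE cycle_of_kap mxE subrr.
Qed.

Lemma boundary_mu i : boundary X e n.+1 (gen L (mu i)) = cycle_of (row i A).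
Proof.
rewrite [LHS]cycle_ofK ?boundary_boundary_gen //; congr cycle_of.
by apply/rowP => j; rewrite !mxE boundary_gen eE rmorph_incidence mulrC.
Qed.

(** The boundary of a simplex [s] is a combination over [L] of those of the [mu i],
    because only simplices [mu i] at least as heavy as [s] occur in [mu_span]. *)
Lemma boundary_im z :
  (exists c, boundary X e n.+1 c = z) <-> exists x, z = cycle_of (x *m A).
Proof.
have muE (x : 'rV_m) : cycle_of (x *m A) =
    \sum_i x 0 i *: boundary X e n.+1 (gen L (mu i)).
  rewrite mulmx_sum_row linear_sum; apply: eq_bigr => i _.
  by rewrite linearZ boundary_mu.
split=> [[c <-]|[x ->]]; last first.
  exists (\sum_i x 0 i *: gen L (mu i)); rewrite muE linear_sum.
  by apply: eq_bigr => i _; rewrite linearZ.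
rewrite [c]chain_gen linear_sum; elim/big_rec: _ => [|s y _ [x ->]].
  by exists 0; rewrite mul0mx linear0.
have [a [aw sE]] := mu_span s.
exists (c s *: (\row_i (iota (a i) * t ^+ (w (mu i) - w s))) + x).
rewrite mulmxDl linearD; congr (_ + _); rewrite -scalemxAl !linearZ_LR; congr (_ *: _).
rewrite [RHS]muE boundary_gen_lift sE lift_chain_sum; apply: eq_bigr => i _.
rewrite mxE -scalerA boundary_gen_lift; have [->|/aw ai] := eqVneq (a i) 0.
  by rewrite rmorph0 !scale0r.
by rewrite -lift_chain_shift //; exact: (@heavy_boundary n.+1 _ _ (@heavy_gen _ _)).
Qed.

(** Homology as the quotient of the coordinate vectors of cycles by the row space of
    the incidence matrix.  The last clause allows classes of cycles to be compared
    across different coefficient rings and boundary maps. *)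
Lemma homology_presentation :
  exists Phi : {linear 'rV[L]_k -> homology (boundary X e n.+1) (boundary X e n)},
    [/\ forall y, exists c, Phi c = y,
        forall c, Phi c = 0 <-> exists x, c = x *m A
      & forall c (z : submod (lin_ker (boundary X e n))),
          val z = cycle_of c -> Phi c = proj _ z].
Proof.
have [p pE] := @corestrict _ _ _ (lin_ker (boundary X e n)) cycle_of cycle_of_ker.
pose pr : {linear submod (lin_ker (boundary X e n)) ->
               homology (boundary X e n.+1) (boundary X e n)} :=
  proj (im_in_ker (boundary X e n.+1) (boundary X e n)).
exists (pr \o p); split=> [y|c|c z zE] /=.
- have [z <-] : exists z, pr z = y by eexists; exact: projK.
  have /eqP/cycle_ofK zE := valP z; exists (\row_j val z (kap j)); congr (pr _).
  by apply: val_inj; rewrite [LHS]pE [RHS]zE.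
- have -> : pr (p c) = 0 <-> p c \in im_in_ker (boundary X e n.+1) (boundary X e n).
    rewrite -(linear0 pr); split=> [/eqP|pc]; first by rewrite proj_eq subr0.
    by apply/eqP; rewrite proj_eq subr0.
  have -> : (p c \in im_in_ker (boundary X e n.+1) (boundary X e n)) <->
            exists y, boundary X e n.+1 y = cycle_of c.
    by rewrite -pE; split => /asboolP.
  rewrite boundary_im; split=> [[x cE]|[x ->]]; exists x => //.
  by apply/rowP => j; rewrite -!cycle_of_kap cE.
by congr (pr _); apply: val_inj; rewrite [LHS]pE zE.
Qed.

End HomologyPresentation.
End Lift.

(** * Consequences of distinguished bipartitions *)

Section Distinguished.
Context {disp : Order.disp_t} {V : finOrderType disp} {X : wcomplex V}.
Variable F : fieldType.
Local Notation R := {fps F}.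
Local Notation w s := (weight X (val s)).
Local Notation pi := (fps_var F).
Local Notation const := (@fpsC F).

Definition separating (A : comNzRingType) (e : {set V} -> {set V} -> A) n
    (K : {set simplex X n}) :=
  forall z : chain X A n, boundary X e n z = 0 -> (forall s, s \in K -> z s = 0) -> z = 0.

Lemma vwt_divE (a c : {set V}) : vwt_div X F a c = pi ^+ (weight X a - weight X c).
Proof. by []. Qed.

(** The coefficients 1 of the ordinary boundary are the case [t = 1] of the powers of
    [t] in the homogeneous one. *)
Lemma ratio_oneE (A : comNzRingType) (a c : {set V}) :
  1 = 1 ^+ (weight X a - weight X c) :> A.
Proof. by rewrite expr1n. Qed.

Lemma lift_chain_eq0 n d (b : chain X F n) : lift_chain const pi d b = 0 -> b = 0.
Proof.
move=> /ffunP lb; apply/ffunP => s; have := lb s; rewrite lift_chainE !ffunE => /eqP.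
rewrite mulf_eq0 (negPf (fps_var_exp_neq0 _ _)) orbF => /eqP.
by rewrite -(rmorph0 const) => /fpsC_inj.
Qed.

Section OneDimension.
Variables (n : nat) (K M : {set simplex X n}).
Hypothesis KM : distinguished F K M.

Lemma distinguished_setC : M = ~: K.
Proof.
have [KUM dKM _ _] := KM; apply/setP => s; rewrite inE.
have := in_setT s; rewrite -KUM inE; case: (boolP (s \in K)) => //= sK _.
by apply/negbTE; rewrite (disjointFr dKM sK).
Qed.

Lemma distinguished_basis : exists beta : simplex X n -> chain X R n,
  [/\ is_basis K beta (lin_ker (wboundary X F n)),
      forall s r, s \in K -> r \in K -> beta s r = (r == s)%:R
    & forall s r, s \in K -> r \notin K -> beta s r != 0 ->
      exists a k, beta s r = fpsC a * pi ^+ k /\ (k + w s)%N = w r].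
Proof.
have [_ _ _ [beta betaK betaE]] := KM.
exists beta; split=> // s r sK; have [x sE xE] := betaE s sK.
  move=> rK; rewrite sE ffunE genE sum_ffunE big1 ?add0r // => y.
  rewrite distinguished_setC inE => yK; rewrite [LHS]chain_scaleE genE.
  by case: eqP yK => [<-|]; rewrite ?rK // mulr0.
move=> rK; have rM : r \in M by rewrite distinguished_setC inE.
have -> : beta s r = x r.
  rewrite sE ffunE genE (_ : (r == s) = false); last by apply: contraNF rK => /eqP->.
  rewrite addr0 sum_ffunE (bigD1 r) //= [X in X + _]chain_scaleE genE eqxx mulr1.
  rewrite big1 ?addr0 // => y /andP[_ yr].
  by rewrite [LHS]chain_scaleE genE eq_sym (negPf yr) mulr0.
by move=> /(xE r rM)[a [k [_ -> <-]]]; exists a, k.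
Qed.

(** The coefficients of the basis vector of index [s] are monomials whose exponents are
    [w r - w s], so that it is the lift of degree [w s] of a chain over [F].  That chain
    is a cycle because lifting is injective and commutes with boundaries. *)
Lemma distinguished_cycles : exists b : simplex X n -> chain X F n,
  forall s, s \in K ->
  [/\ forall r, r \in K -> b s r = (r == s)%:R, heavy (w s) (b s)
    & sboundary X F n (b s) = 0].
Proof.
have [beta [[betaK _ _] beta1 beta2]] := distinguished_basis.
pose b s : chain X F n := [ffun r => coefs (beta s r : R) (w r - w s)].
exists b => s sK.
have bb x : (b s x != 0 -> (w s <= w x)%N) /\
    beta s x = const (b s x) * pi ^+ (w x - w s).
  rewrite ffunE; have [xK|xK] := boolP (x \in K).
    rewrite beta1 //; case: (eqVneq x s) => [->|_].
      by rewrite subnn coefs1 rmorph1 mulr1.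
    by rewrite coefs0 eqxx rmorph0 mul0r.
  have [->|/(beta2 s x sK xK)[a [k [-> <-]]]] := eqVneq (beta s x) 0.
    by rewrite coefs0 eqxx rmorph0 mul0r.
  rewrite addnK coefs_fpsC_mul coefs_var_exp eqxx mulr1.
  by split=> // _; rewrite leq_addl.
have hb : heavy (w s) (b s) by move=> x; apply: (bb x).1.
have lb : beta s = lift_chain const pi (w s) (b s).
  by apply/ffunP => x; rewrite lift_chainE; apply: (bb x).2.
split=> // [x xK|].
  by rewrite ffunE beta1 //; case: eqP => [->|_]; rewrite ?subnn ?coefs1 ?coefs0.
apply: (@lift_chain_eq0 _ (w s)).
rewrite -(boundary_lift const vwt_divE hb) -lb.
exact/eqP/betaK.
Qed.

Lemma separating_weighted : separating (vwt_div X F) K.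
Proof.
have [beta [[_ _ betaS] beta1 _]] := distinguished_basis.
move=> z z0 zK; have [|c zE] := betaS z; first exact/eqP.
rewrite zE big1 // => s sK; suff -> : c s = 0 by rewrite scale0r.
rewrite -(zK s sK) zE sum_ffunE (bigD1 s) //= [X in _ = X + _]chain_scaleE.
rewrite beta1 // eqxx mulr1 big1 ?addr0 // => x /andP[xK /negPf xs].
by rewrite [LHS]chain_scaleE beta1 // eq_sym xs mulr0.
Qed.

(** [theta] is an injective chain map that preserves supports. *)
Lemma separating_fps : separating (fun _ _ => 1 : R) K.
Proof.
move=> z z0 zK; have tz : theta X F n z = 0.
  apply: separating_weighted => [|s sK]; last by rewrite thetaE zK // mulr0.
  by rewrite -/(wboundary X F n) theta_chain_map /sboundary z0 linear0.
apply/ffunP => s; have /eqP := thetaE z s; rewrite tz ffunE eq_sym mulf_eq0.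
by rewrite (negPf (fps_var_exp_neq0 _ _)) => /eqP ->; rewrite ?ffunE.
Qed.

(** Extension of scalars is an injective chain map that preserves supports. *)
Lemma separating_field : separating (fun _ _ => 1 : F) K.
Proof.
move=> z z0 zK; have lz : lift_chain const 1 0 z = 0.
  apply: separating_fps => [|s sK]; last by rewrite lift_chainE zK // rmorph0 mul0r.
  rewrite (boundary_lift const (@ratio_oneE _)) //.
  by rewrite /sboundary z0 lift_chain0.
apply/ffunP => s; have := lift_chainE const 1 0 z s.
by rewrite lz !ffunE expr1n mulr1 -{1}(rmorph0 const) => /fpsC_inj.
Qed.

End OneDimension.

Section TwoDimensions.
Variables (n k m : nat) (K M : {set simplex X n}) (K' M' : {set simplex X n.+1}).
Hypotheses (KM : distinguished F K M) (KM' : distinguished F K' M').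
Variables (kap : 'I_k -> simplex X n) (mu : 'I_m -> simplex X n.+1).
Hypotheses (kapK : enumerates kap K) (muM : enumerates mu M').

Let kap_inj : injective kap := proj1 kapK.
Let kapE : K = [set kap i | i : 'I_k] := proj2 kapK.
Let mu_inj : injective mu := proj1 muM.
Let muE : M' = [set mu i | i : 'I_m] := proj2 muM.

Lemma mu_in i : mu i \in M'. Proof. by rewrite muE; apply: imset_f. Qed.
Lemma kap_in i : kap i \in K. Proof. by rewrite kapE; apply: imset_f. Qed.

(** For [s] in [K'] the cycle of index [s] expresses the boundary of [s] through those
    of simplices of [M'] that are at least as heavy as [s]. *)
Lemma distinguished_span (s : simplex X n.+1) : exists x : 'I_m -> F,
  (forall i, x i != 0 -> (w s <= w (mu i))%N) /\
  sboundary X F n.+1 (gen F s) = \sum_i x i *: sboundary X F n.+1 (gen F (mu i)).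
Proof.
have [sK|sK] := boolP (s \in K'); last first.
  have : s \in M' by rewrite (distinguished_setC KM') inE.
  rewrite muE => /imsetP[i _ ->]; exists (fun j => (j == i)%:R); split=> [j|].
    by case: (eqVneq j i) => [->|_]; rewrite ?eqxx.
  rewrite (bigD1 i) //= eqxx scale1r big1 ?addr0 // => j /negPf ->.
  by rewrite scale0r.
have [b /(_ s sK)[bK bh b0]] := distinguished_cycles KM'.
exists (fun i => - b s (mu i)); split=> [i|]; first by rewrite oppr_eq0 => /bh.
have bE : b s = gen F s + \sum_(i < m) b s (mu i) *: gen F (mu i).
  rewrite {1}[b s]chain_gen (bigID (mem K')) /= (bigD1 s) //= bK // eqxx scale1r.
  rewrite [X in _ + X + _]big1 ?addr0 => [|r /andP[rK /negPf rs]]; last first.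
    by rewrite bK // rs scale0r.
  congr (_ + _); rewrite (eq_bigl (mem M')) => [|r]; last first.
    by rewrite /= (distinguished_setC KM') inE.
  by rewrite muE big_imset //= => i j _ _; apply: mu_inj.
move: b0; rewrite {1}bE linearD linear_sum => /eqP; rewrite addr_eq0 -sumrN => /eqP ->.
by apply: eq_bigr => i _; rewrite linearZ_LR scaleNr.
Qed.

Lemma kap_separating (A : comNzRingType) (e : {set V} -> {set V} -> A) : separating e K ->
  forall z, boundary X e n z = 0 -> (forall j, z (kap j) = 0) -> z = 0.
Proof.
move=> sepK z z0 zk; apply: sepK => // s; rewrite kapE => /imsetP[j _ ->].
exact: zk.
Qed.

Section WithCycles.
Variable b : simplex X n -> chain X F n.
Hypothesis bP : forall s, s \in K ->
  [/\ forall r, r \in K -> b s r = (r == s)%:R, heavy (w s) (b s)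
    & sboundary X F n (b s) = 0].

Let b_kap i j : b (kap i) (kap j) = (j == i)%:R.
Proof. by have [-> //] := bP (kap_in i); rewrite ?(inj_eq kap_inj) // kap_in. Qed.
Let b_heavy i : heavy (w (kap i)) (b (kap i)).
Proof. by have [] := bP (kap_in i). Qed.
Let b_cycle i : sboundary X F n (b (kap i)) = 0.
Proof. by have [] := bP (kap_in i). Qed.

(** A combination [c] of the [mu i] whose boundary has vanishing coefficients on [K] is
    a cycle, because its boundary is a cycle that vanishes on [K].  Then [c] vanishes,
    as it vanishes on [K']. *)
Lemma incidence_mx_free (x : 'rV_m) : x *m incidence_mx F kap mu = 0 -> x = 0.
Proof.
move=> xA; pose c : chain X F n.+1 := \sum_i x 0 i *: gen F (mu i).
have c0 : sboundary X F n.+1 c = 0.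
  apply: (kap_separating (separating_field KM)) => [|j].
    exact: sboundary_sboundary.
  have /rowP/(_ j) := xA; rewrite !mxE => <-.
  rewrite /c linear_sum sum_ffunE; apply: eq_bigr => i _.
  by rewrite linearZ_LR [LHS]chain_scaleE boundary_gen mul1r mxE.
have cE r : c r = \sum_i x 0 i * (r == mu i)%:R.
  by rewrite sum_ffunE; apply: eq_bigr => i _; rewrite [LHS]chain_scaleE genE.
have {}c0 : c = 0.
  apply: (separating_field KM') => // s sK; rewrite cE big1 // => i _.
  case: eqP => [sE|_]; last by rewrite mulr0.
  by have := mu_in i; rewrite -sE (distinguished_setC KM') inE sK.
apply/rowP => i; rewrite mxE; have := cE (mu i); rewrite c0 ffunE => ->.
rewrite (bigD1 i) //= eqxx mulr1 big1 ?addr0 // => j /negPf ji.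
by rewrite (inj_eq mu_inj) eq_sym ji mulr0.
Qed.

Section NormalForm.
Variables (f : 'I_m -> 'I_k) (P P' : 'M[F]_m) (G G' : 'M[F]_k).
Hypothesis PA : P *m incidence_mx F kap mu = rowsub f G.
Hypothesis uf : forall i, (w (mu i) <= w (kap (f i)))%N.
Hypothesis giP : graded_inverse (fun i => w (mu i)) P P'.
Hypothesis giG : graded_inverse (fun j => w (kap j)) G G'.

Local Notation scaleG iota t :=
  (scale_mx iota t (fun j => w (kap j)) (fun j => w (kap j)) G).
Local Notation cycG iota t c :=
  (cycle_of iota t kap (fun i => b (kap i)) (c *m scaleG iota t)).

(** After the change of basis [G], the row space of the incidence matrix is spanned by
    multiples of basis vectors. *)
Lemma homology_presents (L : idomainType) (iota : {rmorphism F -> L}) (t : L) e :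
  (forall a c, e a c = t ^+ (weight X a - weight X c)) -> separating e K ->
  exists Phi : {linear 'rV[L]_k -> homology (boundary X e n.+1) (boundary X e n)},
    presents f Phi (fun i => t ^+ (w (kap (f i)) - w (mu i))) /\
    (forall c (z : submod (lin_ker (boundary X e n))),
      val z = cycG iota t c -> Phi c = proj _ z).
Proof.
move=> eE sepK.
have [Phi [Phis Phi0 Phiz]] := @homology_presentation _ _ _ _ _ iota t e eE n m k kap mu
  (fun i => b (kap i)) b_kap b_heavy b_cycle distinguished_span (kap_separating sepK).
have [GG' G'G] := scale_graded_inverse iota t giG.
exists (Phi \o mulmxr (scaleG iota t)).
split=> [|c z zE] /=; last exact: Phiz.
split=> [y|c] /=.
  have [c <-] := Phis y; eexists; congr (Phi _).
  by rewrite -[RHS]mulmx1 -G'G mulmxA.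
rewrite Phi0; apply: scale_mx_row_space PA uf giP giG c.
exact: incidence_mx_graded.
Qed.

Local Notation diag_v := (diag_mx (\row_j vwt X F (val (kap j)))).

(** [theta] sends the lift of [b (kap j)] for [t = 1] to [v (kap j)] times its lift for
    [t = pi], and the diagonal matrix of the [v (kap j)] intertwines the two lifts of
    the homogeneous matrix [G]. *)
Lemma theta_cycle c :
  theta X F n (cycG const 1 c) = cycG const pi (c *m diag_v).
Proof.
rewrite -mulmxA.
have -> : diag_v *m scaleG const pi = scaleG const 1 *m diag_v.
  apply/matrixP => i j; rewrite mul_diag_mx mul_mx_diag !mxE expr1n mulr1 mulrCA -exprD.
  have [gG _ _ _] := giG.
  have [->|/gG ij] := eqVneq (G i j) 0; first by rewrite rmorph0 !mul0r.
  by rewrite subnKC.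
rewrite mulmxA; set x := c *m _; rewrite /cycle_of linear_sum; apply: eq_bigr => j _.
rewrite linearZ_LR mul_mx_diag !mxE -scalerA; congr (_ *: _).
apply/ffunP => s; rewrite [LHS]thetaE [RHS]chain_scaleE !lift_chainE expr1n mulr1.
have [->|/b_heavy js] := eqVneq (b (kap j) s) 0; first by rewrite rmorph0 mul0r !mulr0.
by rewrite mulrCA -exprD subnKC // mulrC.
Qed.

End NormalForm.
End WithCycles.
End TwoDimensions.
End Distinguished.

(** * The structure of weighted homology *)

Lemma enum_val_enumerates (T : finType) (A : {set T}) m (e : m = #|A|) :
  enumerates (fun i : 'I_m => enum_val (cast_ord e i)) A.
Proof.
subst m; split=> [i j /enum_val_inj/cast_ord_inj //|].
apply/setP => x; apply/idP/imsetP => [xA|[i _ ->]]; last exact: enum_valP.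
by exists (enum_rank_in xA x) => //; rewrite cast_ord_id enum_rankK_in.
Qed.

Lemma enumerates_perm (T : finType) m (f g : 'I_m -> T) A :
  enumerates f A -> enumerates g A -> exists s : 'S_m, forall i, g (s i) = f i.
Proof.
move=> [finj fA] [ginj gA].
have /choice[h hE] : forall i, exists j, g j = f i.
  move=> i; have : f i \in A by rewrite fA imset_f.
  by rewrite gA => /imsetP[j _ ->]; exists j.
have hinj : injective h by move=> i j hij; apply: finj; rewrite -!hE hij.
by exists (perm hinj) => i; rewrite permE.
Qed.

Theorem theorem4 (F : fieldType) (disp : Order.disp_t) (V : finOrderType disp)
    (X : wcomplex V) (n : nat)
    (K M : {set simplex X n}) (K' M' : {set simplex X n.+1}) :
  distinguished F K M -> distinguished F K' M' ->
  (exists (Fn : submodClosed (whomology X F n)) (q : nat) (K1 K2 : {set simplex X n})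
      (kappa1 : 'I_q -> simplex X n) (kappa2 : 'I_(#|K| - q) -> simplex X n),
    [/\ internal_direct_sum Fn (torsion (whomology X F n)),
        is_free (submod Fn),
        [/\ K1 :|: K2 = K, [disjoint K1 & K2],
            enumerates kappa1 K1 & enumerates kappa2 K2],
        exists (i : {linear shomology X {fps F} n -> submod Fn})
            (j : {linear submod Fn ->
                   dirsum (fun s : 'I_q => cyclic_mod (vwt X F (val (kappa1 s))))}),
          (forall x, val (i x) = theta_bar X F n x) /\ short_exact i j
      & #|M'| = (#|K| - q)%N /\
        forall mu : 'I_(#|K| - q) -> simplex X n.+1, enumerates mu M' ->
          exists alpha : 'S_(#|K| - q),
            (forall s, exists c : {fps F},
               vwt X F (val (kappa2 s)) = c * vwt X F (val (mu (alpha s)))) /\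
            lin_iso (submod (torsion (whomology X F n)))
              (dirsum (fun s : 'I_(#|K| - q) =>
                 cyclic_mod (vwt_div X F (val (kappa2 s)) (val (mu (alpha s))))))])
  /\ exists r : nat,
       has_rank (whomology X F n) r /\ has_rank (shomology X F n) r.
Proof.
move=> KM KM'; pose k := #|K|.
pose kap (i : 'I_k) := enum_val (cast_ord (erefl #|K|) i).
have kapK : enumerates kap K := enum_val_enumerates erefl.
have normal_form m (mu : 'I_m -> simplex X n.+1) (muM : enumerates mu M') :=
  graded_normal_form (@incidence_mx_graded _ _ _ F n m k kap mu)
    (incidence_mx_free KM KM' kapK muM).
(* The injection [f] exists for every enumeration of [M'].  A first use of it bounds
   the cardinal of [M'], which allows [M'] to be enumerated by ['I_(k - q)]. *)
have le_m_k : (#|M'| <= k)%N.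
  have [f [_ [_ [_ [_ [finj _ _ _ _]]]]]] := normal_form _ _ (enum_val_enumerates erefl).
  by have := leq_card f finj; rewrite !card_ord.
pose q := (k - #|M'|)%N.
have Em : (k - q)%N = #|M'| by rewrite subKn.
pose mu i := enum_val (cast_ord Em i).
have muM : enumerates mu M' := enum_val_enumerates Em.
have [f [P [P' [G [G' [finj PA uf giP giG]]]]]] := normal_form _ mu muM.
have cfq : q = #|~: [set f i | i : 'I_(k - q)]|.
  by rewrite cardsCs setCK card_imset // !card_ord subKn // leq_subr.
pose g i := enum_val (cast_ord cfq i).
have [ginj gE] : enumerates g (~: [set f i | i : 'I_(k - q)]) := enum_val_enumerates cfq.
have codomE l (h : 'I_l -> 'I_k) j : (j \in codom h) = (j \in [set h i | i : 'I_l]).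
  by apply/codomP/imsetP => [[i ->]|[i _ ->]]; exists i.
have fg j : (j \in codom g) = (j \notin codom f) by rewrite !codomE -gE inE.
have [b bP] := distinguished_cycles KM.
have presentation := homology_presents KM' kapK muM bP PA uf giP giG.
(* The same coordinates present the weighted homology ([PhiV]) and the ordinary
   homology over power series ([PsiR]) and over [F] ([PsiF]). *)
have [PhiV [PhiVP PhiVz]] :=
  presentation _ (@fpsC F) _ _ (@vwt_divE _ _ X F) (separating_weighted KM).
have [PsiR [PsiRP PsiRz]] :=
  presentation _ (@fpsC F) 1 _ (@ratio_oneE _ _ X _) (separating_fps KM).
have [PsiF [PsiFP _]] :=
  presentation _ idfun 1 _ (@ratio_oneE _ _ X _) (separating_field KM).
have v0 j : vwt X F (val (kap j)) != 0 := fps_var_exp_neq0 _ _.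
have d0 i : vwt_div X F (val (kap (f i))) (val (mu i)) != 0 := fps_var_exp_neq0 _ _.
have {}PsiRP : presents f PsiR (fun=> 1).
  by move: PsiRP; congr (presents f _ _); apply/funext => i; rewrite expr1n.
have {}PsiFP : presents f PsiF (fun=> 1).
  by move: PsiFP; congr (presents f _ _); apply/funext => i; rewrite expr1n.
have thE c : theta_bar X F n (PsiR c) =
    PhiV (c *m diag_mx (\row_j vwt X F (val (kap j)))).
  have b_heavy i : heavy (weight X (val (kap i))) (b (kap i)).
    by have [] := bP _ (kap_in kapK i).
  have b_cycle i : sboundary X F n (b (kap i)) = 0 by have [] := bP _ (kap_in kapK i).
  pose z x : submod (lin_ker (sboundary X {fps F} n)) :=
    Submod (cycle_of_ker (@fpsC F) (@ratio_oneE _ _ X _) b_heavy b_cycle x).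
  have PsiRE := PsiRz c (z _) erefl.
  apply: (etrans (congr1 (theta_bar X F n) PsiRE)).
  apply: (etrans (homology_map_proj (@theta_chain_map _ _ X F n.+1) _ _)).
  by apply/esym/PhiVz; apply: (theta_cycle kapK bP giG).
split; last first.
  exists q; split; first exact: (presented_rank finj ginj fg d0 PhiVP).
  by apply: (presented_rank finj ginj fg _ PsiFP) => i; exact: oner_neq0.
exists (free_sub g PhiV), q, [set kap (g i) | i : 'I_q], [set kap (f i) | i : 'I_(k - q)],
  (kap \o g), (kap \o f).
split.
- exact: (direct_sum_torsion finj ginj fg d0 PhiVP).
- exact: (free_sub_is_free ginj fg PhiVP).
- have kap_inj : injective kap := proj1 kapK.
  have enum_comp l (h : 'I_l -> 'I_k) : injective h ->
      enumerates (kap \o h) [set kap (h i) | i : 'I_l].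
    by move=> hinj; split=> //; apply: inj_comp.
  have imE l (h : 'I_l -> 'I_k) :
      [set kap (h i) | i : 'I_l] = kap @: [set h i | i : 'I_l].
    by rewrite -imset_comp.
  split; [| |exact: enum_comp|exact: enum_comp].
    rewrite !imE -imsetU -gE setUC setUCr.
    rewrite [RHS](proj2 kapK); apply/setP => s.
    by apply/imsetP/imsetP => -[i _ ->]; exists i; rewrite ?inE.
  rewrite !imE -setI_eq0 -imsetI; last by move=> x y _ _; apply: kap_inj.
  by rewrite -gE setIC setICr imset0.
- exact: (presented_exact finj ginj fg v0 PsiRP PhiVP thE).
split=> // mu' mu'M; have [alpha alphaE] := enumerates_perm muM mu'M.
exists alpha; split=> [i|].
  exists (vwt_div X F (val (kap (f i))) (val (mu i))); rewrite alphaE.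
  by rewrite vwt_divK.
have -> : (fun s => cyclic_mod (vwt_div X F (val ((kap \o f) s)) (val (mu' (alpha s))))) =
          (fun s => cyclic_mod (vwt_div X F (val (kap (f s))) (val (mu s)))).
  by apply/funext => s; rewrite alphaE.
exact: (torsion_iso finj ginj fg d0 PhiVP).
Qed.
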